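(* Let $n>1$ be an integer. Let $\bar{\mathcal{F}}$ be a family of algebraic subgroups of $GL_n(k)$ whose triangular representations are bounded by $d_3$ (with $d_3$ the explicit function of $n$ given in the context, satisfying $d_3\le n\,8^{\,5.5n^3\,16^{(2n^3)^{149n^8}}}$), such that for any algebraic subgroup $H'\subseteq GL_n(k)$ there exists $\bar H\in\bar{\mathcal{F}}$ with $H'\subseteq\bar H$ and every unipotent element of $\bar H$ in $(H')^{\circ}$. Then for any algebraic subgroup $H'\subseteq GL_n(k)$ there exists $\bar H\in\bar{\mathcal{F}}$ such that $$(\bar H^{\circ})^{t}\trianglelefteq (H')^{\circ}\subseteq H'\subseteq\bar H.$$
   Context: $k$ is a computable algebraically closed field of characteristic zero. For an algebraic subgroup $H\subseteq GL_n(k)$, $H^{\circ}$ denotes its identity component and $(H^{\circ})^{t}$ denotes the intersection of the kernels of all characters of $H^{\circ}$ (characters being homomorphisms of algebraic groups to the multiplicative group $k^*$). Triangular sets. In a polynomial ring $k[x_1,\dots,x_N]$ with fixed variable ordering $x_1<\dots<x_N$, $\mathrm{class}(f)$ denotes the highest indeterminate occurring in $f$. A sequence $G=\{g_1,\dots,g_m\}$ is a triangular set if $\mathrm{class}(g_i)<\mathrm{class}(g_j)$ for all $i<j$. For a polynomial $f$, pseudo-division (successively by $g_m,\dots,g_1$ with respect to their class variables) gives polynomials $q_i$ and $\alpha_i\in\mathbb{N}$ with $\mathrm{lc}(g_1)^{\alpha_1}\cdots \mathrm{lc}(g_m)^{\alpha_m} f=\sum_i q_i g_i+f_0$, where $\mathrm{lc}(g_i)$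 is the leading coefficient of $g_i$ (with respect to its class variable) and $\deg_{x_{j_i}} f_0<\deg_{x_{j_i}} g_i$ if $\mathrm{class}(g_i)=x_{j_i}$; $f_0=:\mathrm{prem}(f,G)$ is the pseudo-remainder. $G$ represents an ideal $I$, written $I=\mathrm{rep}(G)$, if $I=\{f:\mathrm{prem}(f,G)=0\}$. An ideal $I$ has a triangular representation if $\sqrt I=\bigcap_i I_i$ (finite intersection) with radical ideals $I_i=\mathrm{rep}(G_i)$, $G_i$ a triangular set in $I_i$; the representation is bounded by $d$ if every polynomial in every $G_i$ has degree at most $d$. An algebraic subgroup $H\subseteq GL_n(k)$ is given by defining equations $p_1,\dots,p_m\in k[x_{i,j}]_{1\le i,j\le n}$ with $H=\mathrm{zero}(p_1,\dots,p_m)\cap GL_n(k)$. $H$ has a triangular representation (bounded by $d$) if the ideal generated by its defining equations has a triangular representation (bounded by $d$). A family of algebraic subgroups has triangular representations bounded by $d$ if every member has a triangular representation bounded by $d$. Constants: $D=3n^2\big(2n^2(n-1)\big)^{148.5n^6}$, $d_1=\max_i\Big\{\binom{\binom{n^2+D}{D}}{i}^2\Big\}$, $d_2=d_1 D\binom{n^2+D}{D}$, $d_3=n\Big(d_2(d_1^2+1)\max_i\Big\{\binom{d_1^2+1}{i}^2\Big\}\Big)^{5.5n^3}$. *)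

(* Defs.v *)
From mathcomp Require Export all_boot all_order all_algebra perm.
From mathcomp Require Export realalg.
From mathcomp Require Export mpoly.

Set Implicit Arguments.
Unset Strict Implicit.
Unset Printing Implicit Defensive.

Import Order.TTheory GRing.Theory Num.Theory.
Local Open Scope ring_scope.

(* Total recursive functions, as the closure of the initial functions under
   composition, primitive recursion and minimization of regular functions
   (Kleene); [rec_prec] and [rec_min] characterize the new function [f] by its
   defining equations. *)
Inductive recursive : forall n, (n.-tuple nat -> nat) -> Prop :=
| rec_zero n : recursive (fun _ : n.-tuple nat => 0%N)
| rec_succ : recursive (fun v : 1.-tuple nat => (thead v).+1)
| rec_proj n (i : 'I_n) : recursive (fun v : n.-tuple nat => tnth v i)
| rec_comp m n (g : m.-tuple nat -> nat) (h : 'I_m -> n.-tuple nat -> nat) :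
    recursive g -> (forall i, recursive (h i)) ->
    recursive (fun v : n.-tuple nat => g [tuple h i v | i < m])
| rec_prec n (g : n.-tuple nat -> nat) (h : n.+2.-tuple nat -> nat)
    (f : n.+1.-tuple nat -> nat) :
    recursive g -> recursive h ->
    (forall v : n.-tuple nat, f [tuple of 0%N :: v] = g v) ->
    (forall x (v : n.-tuple nat),
      f [tuple of x.+1 :: v] =
      h [tuple of x :: [tuple of f [tuple of x :: v] :: v]]) ->
    recursive f
| rec_min n (g : n.+1.-tuple nat -> nat) (f : n.-tuple nat -> nat) :
    recursive g ->
    (forall v : n.-tuple nat, g [tuple of f v :: v] = 0%N) ->
    (forall (v : n.-tuple nat) y,
      (y < f v)%N -> g [tuple of y :: v] <> 0%N) ->
    recursive f.

(* Computable fields in the sense of Rabin: the elements of [k] have codes in a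
   recursive set of natural numbers, on which the field operations are
   recursive. *)
Definition computable_field (k : fieldType) : Prop :=
  exists code : k -> nat,
    injective code /\
    (exists2 chi : 1.-tuple nat -> nat, recursive chi &
      forall c, chi [tuple c] = 1%N <-> exists x, code x = c) /\
    (exists2 add : 2.-tuple nat -> nat, recursive add &
      forall x y, add [tuple code x; code y] = code (x + y)) /\
    (exists2 opp : 1.-tuple nat -> nat, recursive opp &
      forall x, opp [tuple code x] = code (- x)) /\
    (exists2 mul : 2.-tuple nat -> nat, recursive mul &
      forall x y, mul [tuple code x; code y] = code (x * y)) /\
    (exists2 inv : 1.-tuple nat -> nat, recursive inv &
      forall x, inv [tuple code x] = code (x^-1)).

Section Triangular.
Variables (k : fieldType) (N : nat).
Implicit Types (f g p : {mpoly k[N]}) (G : seq {mpoly k[N]}).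
Implicit Types I J : {mpoly k[N]} -> Prop.

Definition is_ideal I : Prop :=
  [/\ I 0, forall f g, I f -> I g -> I (f + g) & forall f g, I g -> I (f * g)].

Definition ideal_gen (ps : seq {mpoly k[N]}) : {mpoly k[N]} -> Prop :=
  fun f => exists q : 'I_(size ps) -> {mpoly k[N]},
    f = \sum_(i < size ps) q i * ps`_i.

Definition radical I : {mpoly k[N]} -> Prop := fun f => exists e, I (f ^+ e.+1).

Definition radical_ideal I : Prop :=
  is_ideal I /\ forall f, radical I f -> I f.

(* The variable ordering is given by a permutation [s]: the variable ['X_i] is
   smaller than ['X_j] iff [s i < s j]. *)
Variable s : 'S_N.

Definition occurs (i : 'I_N) f : bool := has (fun m : 'X_{1..N} => m i != 0%N) (msupp f).

(* [None] for constant polynomials. *)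
Definition class f : option 'I_N :=
  [pick i | occurs i f & [forall j, occurs j f ==> (s j <= s i)%N]].

(* In particular the elements of a triangular set are not constant. *)
Definition triangular G : Prop :=
  exists2 c : seq 'I_N,
    map class G = map some c & pairwise (fun i j => (s i < s j)%N) c.

(* [f] as a polynomial in the variable ['X_i], with coefficients (not
   involving ['X_i]) in the ring of all polynomials. *)
Definition univ (i : 'I_N) f : {poly {mpoly k[N]}} :=
  mmap (fun c : k => (c%:MP)%:P) (fun j => if j == i then 'X else ('X_j)%:P) f.

(* [rmodp] multiplies the dividend by the leading coefficient of the divisor
   at each reduction step. *)
Definition prem1 g f : {mpoly k[N]} :=
  if class g is Some i
  then (Pdiv.CommonRing.rmodp (univ i f) (univ i g)).['X_i] else f.

(* The rightmost element of [G] is used first. *)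
Definition prem f G : {mpoly k[N]} := foldr prem1 f G.

Definition rep G : {mpoly k[N]} -> Prop := fun f => prem f G = 0.

(* Degrees are total degrees; the bound is a real algebraic number because
   [d3] below need not be an integer. *)
Definition degrees_le (d : realalg) G : Prop :=
  forall g, g \in G -> ((msize g).-1)%:R <= d.

Definition triangular_rep_bounded (d : realalg) I : Prop :=
  exists Gs : seq (seq {mpoly k[N]}),
    (forall G, G \in Gs ->
      [/\ triangular G, radical_ideal (rep G),
          forall g, g \in G -> rep G g & degrees_le d G]) /\
    (forall f, radical I f <-> forall G, G \in Gs -> rep G f).

End Triangular.

Section MatrixSets.
Variables (k : fieldType) (n : nat).
Implicit Types (A B C H N : 'M[k]_n -> Prop) (p : {mpoly k[n * n]}).

Definition subset_of A B : Prop := forall M, A M -> B M.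

Definition is_subgroup H : Prop :=
  [/\ subset_of H (fun M => M \in unitmx), H 1%:M,
      forall M M', H M -> H M' -> H (M *m M') & forall M, H M -> H (invmx M)].

Definition normal_subgroup N H : Prop :=
  [/\ is_subgroup N, is_subgroup H, subset_of N H &
      forall g h, H g -> N h -> N (g *m h *m invmx g)].

(* The variable of index [mxvec_index i j] stands for the entry x_(i,j). *)
Definition mxeval p (M : 'M[k]_n) : k := p.@[fun l => mxvec M 0 l].

Definition zeroGL (ps : seq {mpoly k[n * n]}) : 'M[k]_n -> Prop :=
  fun M => M \in unitmx /\ forall p, p \in ps -> mxeval p M = 0.

(* Two presentations of the same group are different objects: having a
   triangular representation depends on the ideal of the given equations. *)
Record alg_subgroup := AlgSubgroup {
  equations : seq {mpoly k[n * n]};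
  points := zeroGL equations;
  pointsP : is_subgroup points }.

Definition zariski_closed C : Prop :=
  exists P : {mpoly k[n * n]} -> Prop,
    forall M, C M <-> forall p, P p -> mxeval p M = 0.

Definition zariski_connected A : Prop :=
  forall C1 C2, zariski_closed C1 -> zariski_closed C2 ->
    (forall M, A M -> C1 M \/ C2 M) ->
    (exists2 M, A M & C1 M) -> (exists2 M, A M & C2 M) ->
    exists2 M, A M & C1 M /\ C2 M.

(* The connected component of the identity. *)
Definition id_component H : 'M[k]_n -> Prop :=
  fun M => exists A,
    [/\ zariski_connected A, subset_of A H, A 1%:M & A M].

(* Regular functions on a closed subset of GL_n are the restrictions of
   elements of k[x_(i,j), 1/det]. *)
Definition regular_on H (f : 'M[k]_n -> k) : Prop :=
  exists p e, forall M, H M -> f M = mxeval p M / (\det M) ^+ e.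

Definition is_character H (chi : 'M[k]_n -> k) : Prop :=
  [/\ regular_on H chi, forall M, H M -> chi M != 0 &
      forall M M', H M -> H M' -> chi (M *m M') = chi M * chi M'].

(* Usually written [H^t]: the intersection of the kernels of all
   characters of [H]. *)
Definition char_kernel H : 'M[k]_n -> Prop :=
  fun M => H M /\ forall chi, is_character H chi -> chi M = 1.

Definition unipotent (M : 'M[k]_n) : Prop :=
  exists e, (M - 1%:M) ^+ e = 0.

End MatrixSets.

Section Constants.

(* b ^ (e / 2) *)
Definition half_pow (b e : nat) : realalg := Num.sqrt (b%:R ^+ e).

Definition max_binom_sq (b : nat) : nat := \max_(i < b.+1) 'C(b, i) ^ 2.

Variable n : nat.

(* 148.5 = 297 / 2.  For odd n the number is in general irrational; it is a
   bound on degrees, used as an argument of binomial coefficients, and is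
   therefore rounded (up) to a natural number. *)
Definition D : nat :=
  absz (Num.ceil ((3 * n ^ 2)%:R
                  * half_pow (2 * n ^ 2 * (n - 1)) (297 * n ^ 6))).

Definition d1 : nat := max_binom_sq 'C(n ^ 2 + D, D).

Definition d2 : nat := d1 * D * 'C(n ^ 2 + D, D).

(* 5.5 = 11 / 2 *)
Definition d3 : realalg :=
  n%:R * half_pow (d2 * (d1 ^ 2 + 1) * max_binom_sq (d1 ^ 2 + 1)) (11 * n ^ 3).

Definition d3_bound : realalg :=
  n%:R * half_pow 8 (11 * n ^ 3 * 16 ^ ((2 * n ^ 3) ^ (149 * n ^ 8))).

End Constants.

(* Main.v *)
From HB Require Import structures.
Require Import Defs.
From Stdlib Require Import Classical ClassicalEpsilon.
From mathcomp Require Import zify ring lra.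

Set Implicit Arguments.
Unset Strict Implicit.
Unset Printing Implicit Defensive.

Import Order.TTheory GRing.Theory Num.Theory.
Local Open Scope ring_scope.

(* Let G be the identity component of Hbar and K that of H'. For the second
   part it is enough that every g in G killed by all characters of G lies in
   the smallest closed subgroup N containing the exponentials of the nilpotent
   elements of Lie(G): these exponentials are unipotent elements of Hbar,
   because polynomials vanishing on G are stable under the derivations of
   Lie(G), so N is contained in K.

   By Chevalley's argument N is cut out by polynomials which are right
   semi-invariant, hence invariant, under N. Nilpotent elements of Lie(G)
   annihilate N-invariants. By the Jordan decomposition in Lie(G), every
   X in Lie(G) thus acts on invariants as its semisimple part, and the brackets
   act by 0; so each invariant is a sum of simultaneous eigenfunctions w of
   Lie(G). A left translate of w is again an eigenfunction with the same
   eigenvalues, and an eigenfunction with a zero vanishes near it (Euler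
   operator and Krull's intersection theorem), hence on the connected group G.
   So w (g x) = chi (g) w (x) for a character chi, and the invariants do not
   separate g from 1. *)

(** * The numerical bound *)

(** The hypothesis controls unipotent elements only, whereas Lie(G) also has semisimple elements,
    whose exponentials are not polynomial in the parameter; what these do on G has to be detected by
    characters. Two facts are behind the steps named above. The multiplier of a semi-invariant under
    N is, along t -> exp (t X), a polynomial without zeros, hence constant. An eigenvector of ad S
    with nonzero eigenvalue is nilpotent, so a bracket [S, Y] acts on invariants through nilpotent
    elements of Lie(G). Since invariance is only known on G, eigenvalue equations hold only modulo
    the ideal of polynomials vanishing on G. An eigenvalue equation cannot be integrated along paths
    over a general field: vanishing at a point is first propagated formally, to all powers of the
    maximal ideal m there, then to a neighbourhood. Characteristic zero enters because a polynomial
    in t is determined by its derivatives at 0, because the multiples of a nonzero eigenvalue are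
    distinct, and because the Euler operator acts on m^r / m^(r+1), for positive r, by an invertible
    scalar. *)

Lemma bin_le_exp2 b i : ('C(b, i) <= 2 ^ b)%N.
Proof.
elim: b i => [|b IHb] [|i] //; first by rewrite bin0 expn_gt0.
by rewrite binS expnS mul2n -addnn leq_add.
Qed.

Lemma max_binom_sq_le b : (max_binom_sq b <= 4 ^ b)%N.
Proof.
apply/bigmax_leqP => i _; rewrite -[4%N]/((2 ^ 2)%N) -expnM mulnC expnM.
by rewrite leq_exp2r // bin_le_exp2.
Qed.

(** From [m] to [m.+1] the binomial is multiplied by (m + 1 + d) / (m + 1), which is at most d +
    1. *)
Lemma bin_le_expS m d : ('C(m + d, m) <= d.+1 ^ m)%N.
Proof.
elim: m => [|m IHm]; first by rewrite bin0.
rewrite -(leq_pmul2l (ltn0Sn m)) addSn -mul_bin_diag /= expnS mulnA.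
by apply: leq_mul => //; rewrite mulnS mulSn addSn; lia.
Qed.

Lemma quad_le_exp2 y : (16 <= y)%N -> (4 * y * y.+1 <= 2 ^ y)%N.
Proof.
elim: y => // y IHy; rewrite leq_eqVlt => /predU1P[<- //|y_ge].
by have := IHy y_ge; rewrite expnS; nia.
Qed.

Section Bounds.
Variable n : nat.
Hypothesis n_gt1 : (1 < n)%N.

Let t := (2 * n ^ 3)%N.

Lemma D_lt : (D n < t ^ (149 * n ^ 6))%N.
Proof.
set T := (t ^ _)%N; have t_gt0 : (0 < t)%N by rewrite muln_gt0 expn_gt0; lia.
have T_gt0 : (0 < T)%N by rewrite expn_gt0 t_gt0.
rewrite -(ltn_predK T_gt0) ltnS -lez_nat /D.
set x : realalg := _ * half_pow _ _.
have x_ge0 : 0 <= x by rewrite mulr_ge0 ?ler0n ?sqrtr_ge0.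
rewrite gez0_abs ?ceil_ge0 ?(lt_le_trans _ x_ge0) ?ltrN10 //.
rewrite ceil_le_int -[_%:~R]/(_%:R) -subn1 natrB //.
(* The target is [T] = s * r: 149 exceeds 148.5 by one half, and the spare factor [r] = t^(n^6 / 2)
   absorbs both 3 n^2 and the rounding up in [D]. *)
pose s : realalg := half_pow t (297 * n ^ 6); pose r : realalg := half_pow t (n ^ 6).
have le_xs : x <= (3 * n ^ 2)%:R * s.
  rewrite ler_wpM2l ?ler0n // /s /half_pow ler_wsqrtr // lerXn2r ?nnegrE ?ler0n // ler_nat.
  by rewrite /t !expnS; nia.
have s_ge1 : 1 <= s.
  by rewrite -[1]sqrtr1 ler_wsqrtr // -natrX ler1n expn_gt0 t_gt0.
have r_ge : (3 * n ^ 2)%:R + 1 <= r.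
  rewrite -[_ + 1]ger0_norm ?addr_ge0 ?ler0n // -sqrtr_sqr ler_wsqrtr //.
  rewrite natr1 -!natrX ler_nat (@leq_trans (t ^ 2)) ?leq_pexp2l //.
    by rewrite leq_exp2r // /t !expnS; nia.
  by rewrite (@leq_trans (2 ^ 6)) // leq_exp2r.
have -> : T%:R = s * r.
  rewrite /s /r /half_pow -sqrtrM ?exprn_ge0 ?ler0n // -exprD.
  have -> : (297 * n ^ 6 + n ^ 6 = 149 * n ^ 6 * 2)%N by lia.
  by rewrite exprM sqrtr_sqr ger0_norm ?exprn_ge0 ?ler0n // natrX.
by nra.
Qed.

(** With lower index n^2 the binomial is at most (D + 1)^(n^2), and strictness in [D_lt] absorbs the
    + 1. The exponents 6 and 2 add up to the 8 of [d3_bound]. *)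
Lemma bin_D_le : ('C(n ^ 2 + D n, D n) <= t ^ (149 * n ^ 8))%N.
Proof.
rewrite -bin_sub ?leq_addl // addnK (leq_trans (bin_le_expS _ _)) //.
have -> : (149 * n ^ 8 = 149 * n ^ 6 * n ^ 2)%N by rewrite -mulnA -expnD.
by rewrite expnM leq_exp2r ?expn_gt0 ?D_lt //; lia.
Qed.

Lemma D_le_bin : (D n <= 'C(n ^ 2 + D n, D n))%N.
Proof.
apply: leq_trans (leq_bin2l (D n) (_ : (D n).+1 <= _)%N); first by rewrite binSn.
by rewrite -add1n leq_add2r expn_gt0; lia.
Qed.

Lemma d3_le_d3_bound : d3 n <= d3_bound n.
Proof.
rewrite /d3 /d3_bound ler_wpM2l ?ler0n // /half_pow ler_wsqrtr //.
set B := 'C(n ^ 2 + D n, D n); set E := (16 ^ _)%N.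
rewrite -!natrX ler_nat [X in (8 ^ X)%N]mulnC [X in (_ <= X)%N]expnM.
rewrite leq_exp2r ?muln_gt0 ?expn_gt0 ?(ltnW n_gt1) //.
(* Both d1^2 and d2 = d1 D B are at most [Y], since d1 <= 4^B and D <= B <= 2^B. The base of the
   power in [d3] is thus at most Y (Y + 1) 4^(Y + 1), and 4 Y (Y + 1) <= 2^Y turns this into 8^Y. *)
pose Y := (16 ^ B)%N.
have B_gt0 : (0 < B)%N by rewrite bin_gt0 leq_addl.
have Y_ge : (16 <= Y)%N by rewrite -{1}[16%N]expn1 leq_pexp2l.
have le_YE : (Y <= E)%N by rewrite leq_pexp2l // bin_D_le.
have d1_le : (d1 n <= 4 ^ B)%N by apply: max_binom_sq_le.
have d1_sq : (d1 n ^ 2 <= Y)%N.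
  by rewrite /Y -[16%N]/((4 ^ 2)%N) -expnM mulnC expnM leq_exp2r.
have d2_le : (d2 n <= Y)%N.
  have B_le : (B <= 2 ^ B)%N by apply/ltnW/ltn_expl.
  have -> : Y = (4 ^ B * 2 ^ B * 2 ^ B)%N by rewrite -!expnMn.
  by rewrite !leq_mul // (leq_trans D_le_bin).
apply: (@leq_trans (8 ^ Y)); last by rewrite leq_pexp2l.
apply: (@leq_trans (Y * Y.+1 * 4 ^ Y.+1)).
  apply: leq_mul; first by apply: leq_mul => //; rewrite addn1.
  by apply: leq_trans (max_binom_sq_le _) _; rewrite leq_pexp2l // addn1.
have -> : (8 ^ Y = 2 ^ Y * 4 ^ Y)%N by rewrite -expnMn.
by rewrite expnS mulnA leq_mul // mulnC mulnA quad_le_exp2.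
Qed.

End Bounds.

(** * Noetherianity and Krull's intersection theorem *)

Lemma mpoly_alg_ind (R : comNzRingType) N (P : {mpoly R[N]} -> Prop) :
  (forall c, P c%:MP) -> (forall i, P 'X_i) ->
  (forall p q, P p -> P q -> P (p + q)) ->
  (forall p q, P p -> P q -> P (p * q)) -> forall p, P p.
Proof.
move=> PC PX PD PM; elim/mpolyind => [|c m p _ _ Pp].
  by rewrite -mpolyC0; apply: PC.
apply: PD => //; rewrite -mul_mpolyC; apply: (PM) => //.
rewrite mpolyXE_id; apply: big_ind => [||i _]; [by rewrite -mpolyC1|exact: PM|].
elim: (m i) => [|e IHe]; first by rewrite expr0 -mpolyC1.
by rewrite exprS; apply: PM.
Qed.

(** Each new index is a position where [g] is minimal on the remaining tail. *)
Lemma nondecreasing_subseq (g : nat -> nat) :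
  exists f : nat -> nat,
    (forall i, f i < f i.+1)%N /\ forall i, (g (f i) <= g (f i.+1))%N.
Proof.
have ex_argmin a : exists i, (a <= i)%N /\ forall j, (a <= j)%N -> (g i <= g j)%N.
  suff H m b : (a <= b)%N -> (g b < m)%N ->
      exists i, (a <= i)%N /\ forall j, (a <= j)%N -> (g i <= g j)%N.
    by apply: (H (g a).+1 a).
  elim: m b => // m IHm b le_ab lt_b.
  have [[j [le_aj lt_jb]]|no_j] :=
      classic (exists j, (a <= j)%N /\ (g j < g b)%N).
    by apply: (IHm j) => //; apply: leq_trans lt_jb _.
  by exists b; split=> // j le_aj; rewrite leqNgt; apply/negP => ?; apply: no_j; exists j.
pose next a := sval (constructive_indefinite_description _ (ex_argmin a)).
have nextP a : (a <= next a)%N /\ forall j, (a <= j)%N -> (g (next a) <= g j)%N.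
  exact: svalP (constructive_indefinite_description _ (ex_argmin a)).
pose f := fix f i := if i is i'.+1 then next (f i').+1 else next 0.
have f_lt i : (f i < f i.+1)%N by have [] := nextP (f i).+1.
exists f; split=> // -[|i].
  by apply: (nextP 0).2.
by apply: (nextP (f i).+1).2; apply: leq_trans (ltnW (f_lt i.+1)); apply: f_lt.
Qed.

(** Subsequences are extracted for one coordinate after the other; a coordinate that is already
    nondecreasing stays so. The first two terms of the last subsequence are then comparable. *)
Lemma dickson N (f : nat -> 'X_{1..N}) :
  exists i j, (i < j)%N /\ (f i <= f j)%MM.
Proof.
suff [h [h_lt le_fh]] : exists h : nat -> nat, (forall i, h i < h i.+1)%N /\
    forall l, l \in enum 'I_N -> forall i, (f (h i) l <= f (h i.+1) l)%N.
  exists (h 0), (h 1); split=> //; apply/mnm_lepP => l.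
  by apply: le_fh; rewrite mem_enum.
elim: (enum _) => [|l s [h [h_lt le_fh]]]; first by exists id.
have [h' [h'_lt le_fh']] := nondecreasing_subseq (fun i => f (h i) l).
exists (h \o h'); split=> [i|l' /=].
  exact: (homo_ltn (r := fun x y : nat => (x < y)%N) (fun _ _ _ => @ltn_trans _ _ _) h_lt).
rewrite inE => /orP[/eqP-> //|s_l'] i.
apply: (homo_leq (f := fun i => f (h i) l') (r := fun x y : nat => (x <= y)%N)) => //.
- by move=> y x z; apply: leq_trans.
- by move=> j; apply: le_fh.
- exact: ltnW.
Qed.

Section Noether.
Variables (k : fieldType) (N : nat).
Implicit Types (I J : {mpoly k[N]} -> Prop) (f g p u : {mpoly k[N]}).

Lemma ideal0 I : is_ideal I -> I 0. Proof. by case. Qed.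
Lemma idealD I f g : is_ideal I -> I f -> I g -> I (f + g).
Proof. by case=> _ H _; apply: H. Qed.
Lemma idealM I f g : is_ideal I -> I g -> I (f * g).
Proof. by case=> _ _ H; apply: H. Qed.
Lemma idealMr I f g : is_ideal I -> I f -> I (f * g).
Proof. by rewrite mulrC; apply: idealM. Qed.
Lemma idealN I f : is_ideal I -> I f -> I (- f).
Proof. by rewrite -mulN1r; apply: idealM. Qed.
Lemma idealB I f g : is_ideal I -> I f -> I g -> I (f - g).
Proof. by move=> idI If Ig; apply: idealD => //; apply: idealN. Qed.
Lemma idealZ I c f : is_ideal I -> I f -> I (c *: f).
Proof. by rewrite -mul_mpolyC; apply: idealM. Qed.
Lemma ideal_sum I (T : Type) (r : seq T) (P : pred T) (F : T -> {mpoly k[N]}) :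
  is_ideal I -> (forall i, P i -> I (F i)) -> I (\sum_(i <- r | P i) F i).
Proof.
by move=> idI IF; apply: big_ind => // [|f g]; [apply: ideal0|apply: idealD].
Qed.

(** If every step were strict, choose in each difference an element with minimal leading monomial.
    By Dickson one of these monomials divides a later one, and cancelling the later leading term by
    a multiple of the earlier element contradicts minimality. *)
Lemma ideal_chain_stable (C : nat -> {mpoly k[N]} -> Prop) :
  (forall i, is_ideal (C i)) -> (forall i f, C i f -> C i.+1 f) ->
  exists i, forall f, C i.+1 f -> C i f.
Proof.
move=> idC subC; apply: NNPP => unstable.
have ex_f i : exists f, (C i.+1 f /\ ~ C i f) /\
    forall g, C i.+1 g -> ~ C i g -> ~ (mlead g < mlead f)%O.
  have [f0 Pf0] : exists f, C i.+1 f /\ ~ C i f.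
    apply: NNPP => H; apply: unstable; exists i => f Cf.
    by apply: NNPP => NCf; apply: H; exists f.
  have [m def_m] : exists m, m = mlead f0 by exists (mlead f0).
  elim: {m}(ltom_wf m) f0 def_m Pf0 => m _ IHm f0 def_m Pf0.
  have [[g [Cg NCg lt_g]]|no_g] := classic (exists g,
      [/\ C i.+1 g, ~ C i g & (mlead g < m)%O]).
    by apply: (IHm (mlead g) _ g).
  exists f0; split=> // g Cg NCg lt_g; apply: no_g; exists g.
  by rewrite def_m.
pose F i := sval (constructive_indefinite_description _ (ex_f i)).
have FP i : (C i.+1 (F i) /\ ~ C i (F i)) /\
    forall g, C i.+1 g -> ~ C i g -> ~ (mlead g < mlead (F i))%O.
  exact: svalP (constructive_indefinite_description _ (ex_f i)).
have [i [j [lt_ij le_m]]] := dickson (fun i => mlead (F i)).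
have subC_ij a : C i.+1 a -> C j a.
  elim: j lt_ij {le_m} => // j IHj; rewrite ltnS leq_eqVlt => /predU1P[->//|lt_ij].
  by move=> Ca; apply/subC/IHj.
have [[Ci NCi] _] := FP i; have [[Cj NCj] min_j] := FP j.
have nz_i : F i != 0 by apply/eqP=> F0; apply: NCi; rewrite F0; apply: ideal0.
have nz_j : F j != 0 by apply/eqP=> F0; apply: NCj; rewrite F0; apply: ideal0.
pose q : {mpoly k[N]} := (mleadc (F j) / mleadc (F i)) *: 'X_[mlead (F j) - mlead (F i)].
have Cq : C j (q * F i) by apply: idealM => //; apply: subC_ij.
pose g := F j - q * F i.
have NCg : ~ C j g.
  by move=> Cg; apply: NCj; rewrite -[F j](subrK (q * F i)); apply: idealD.
apply: (min_j g) => //.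
  by apply: idealB => //; apply: subC.
have nz_c : mleadc (F j) / mleadc (F i) != 0.
  by rewrite mulf_neq0 ?invr_neq0 ?mleadc_eq0.
have le_q : (mlead (q * F i) <= mlead (F j))%O.
  apply: le_trans (mleadM_le _ _) _; rewrite mleadZ // mleadXm.
  by rewrite submK.
have lead_q : (q * F i)@_(mlead (F j)) = mleadc (F j).
  rewrite -{1}(submK le_m) /q mulrC -scalerAr mcoeffZ mcoeffMX.
  by rewrite divfK // mleadc_eq0.
rewrite lt_neqAle; apply/andP; split.
  apply/eqP=> eq_m; have /eqP : mleadc g = 0.
    by rewrite eq_m mcoeffB lead_q subrr.
  by rewrite mleadc_eq0 => /eqP g0; apply: NCg; rewrite g0; apply: ideal0.
apply: le_trans (mleadB_le _ _) _; rewrite leUx lexx /=; exact: le_q.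
Qed.

Lemma maximal_ideal_exists (P : ({mpoly k[N]} -> Prop) -> Prop) I :
  (forall J, P J -> is_ideal J) -> P I ->
  exists J, [/\ P J, forall f, I f -> J f &
    forall J', P J' -> (forall f, J f -> J' f) -> forall f, J' f -> J f].
Proof.
move=> P_id PI; apply: NNPP => no_max.
pose above J := P J /\ forall f, I f -> J f.
have step J : above J -> exists J', above J' /\
    ((forall f, J f -> J' f) /\ ~ forall f, J' f -> J f).
  case=> PJ IJ; apply: NNPP => no_J'; apply: no_max; exists J; split=> // J' PJ' JJ'.
  apply: NNPP => NJ; apply: no_J'; exists J'; split=> //; split=> // f /IJ.
  exact: JJ'.
pose T := {J | above J}.
pose next (J : T) : T :=
  let H := constructive_indefinite_description _ (step _ (svalP J)) in
  exist above (sval H) (svalP H).1.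
have nextP (J : T) : (forall f, sval J f -> sval (next J) f) /\
    ~ forall f, sval (next J) f -> sval J f.
  exact: (svalP (constructive_indefinite_description _ (step _ (svalP J)))).2.
pose T0 : T := exist above I (conj PI (fun f If => If)).
have [||i] := @ideal_chain_stable (fun i => sval (iter i next T0)).
- by move=> i; have [/P_id] := svalP (iter i next T0).
- by move=> i; apply: (nextP _).1.
- exact: (nextP (iter i next T0)).2.
Qed.

(** For an ideal [I] this is I + (y)^r. The recursive form peels off one factor [y l] at a time,
    which spares generating sets of monomials. *)
Fixpoint adic I (y : 'I_N -> {mpoly k[N]}) r : {mpoly k[N]} -> Prop :=
  if r is r'.+1 then fun f => exists a,
    (forall l, adic I y r' (a l)) /\ I (f - \sum_l y l * a l)
  else fun _ => True.

Lemma adic_sub I J (y : 'I_N -> {mpoly k[N]}) r :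
  is_ideal J -> (forall f, I f -> J f) ->
  (forall s : seq 'I_N, size s = r -> J (\prod_(l <- s) y l)) ->
  forall f, adic I y r f -> J f.
Proof.
elim: r J => [|r IHr] J idJ IJ Jprod f /=.
  by move=> _; have := Jprod [::] erefl; rewrite big_nil -[f]mulr1; apply: idealM.
case=> a [ad_a If]; rewrite -[f](subrK (\sum_l y l * a l)).
apply: idealD => //; first exact: IJ.
apply: ideal_sum => // l _.
(* The induction hypothesis is applied to the colon ideal J : y l, which is why [J] is
   generalized. *)
apply: (IHr (fun g => J (y l * g))) => //.
- split=> [|g h Jg Jh|g h Jg]; first by rewrite mulr0; apply: ideal0.
    by rewrite mulrDr; apply: idealD.
  by rewrite mulrCA; apply: idealM.
- by move=> g /IJ; apply: idealM.
- by move=> s sz_s; have := Jprod (l :: s); rewrite big_cons /= sz_s; apply.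
Qed.

Lemma prod_pigeonhole J (y : 'I_N -> {mpoly k[N]}) e (s : seq 'I_N) :
  is_ideal J -> (forall l, J (y l ^+ e)) -> (N * e < size s)%N ->
  J (\prod_(l <- s) y l).
Proof.
move=> idJ Jy lt_s.
have [l le_e] : exists l, (e <= count_mem l s)%N.
  apply: NNPP => no_l; move: lt_s; apply/negP; rewrite -leqNgt.
  rewrite -sum1_size (partition_big id xpredT) //=.
  have -> : (N * e = \sum_(l < N) e)%N by rewrite sum_nat_const card_ord.
  apply: leq_sum => l _; rewrite sum1_count leqNgt; apply/negP => lt_e.
  by apply: no_l; exists l; apply: ltnW.
rewrite (bigID (pred1 l)) /=; apply: idealMr => //.
rewrite (eq_bigr (fun=> y l)) => [|_ /eqP-> //].
rewrite big_const_seq iter_mulr_1 -(subnK le_e) exprD.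
exact: idealM.
Qed.

(* Noetherian induction: [q] is an ideal maximal among those containing
   [I + (y) u] but not [u]; each [y l] is nilpotent modulo [q], since for
   [t = y l] the ideals [q : t ^ i] are stationary. *)
Lemma krull_intersection I (y : 'I_N -> {mpoly k[N]}) u :
  is_ideal I -> (forall r, adic I y r u) ->
  exists b : 'I_N -> {mpoly k[N]}, I (u - (\sum_l y l * b l) * u).
Proof.
move=> idI ad_u.
pose Q0 f := exists b : 'I_N -> {mpoly k[N]}, I (f - (\sum_l y l * b l) * u).
have idQ0 : is_ideal Q0.
  split=> [|f g [b Ib] [c Ic]|f g [b Ib]].
  - exists (fun=> 0); rewrite big1 ?mul0r ?subr0 => [|l _]; last by rewrite mulr0.
    exact: ideal0.
  - exists (fun l => b l + c l).
    under eq_bigr => l _ do rewrite mulrDr.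
    by rewrite big_split /= mulrDl opprD addrACA; apply: idealD.
  - exists (fun l => f * b l).
    under eq_bigr => l _ do rewrite mulrCA.
    by rewrite -mulr_sumr -mulrA -mulrBr; apply: idealM.
apply: NNPP; rewrite -/(Q0 u) => NQ0u.
have [q [[idq Nqu] sub_q max_q]] :=
  @maximal_ideal_exists (fun J => is_ideal J /\ ~ J u) Q0 (fun J => @proj1 _ _) (conj idQ0 NQ0u).
have qI f : I f -> q f.
  move=> If; apply: sub_q; exists (fun=> 0).
  by rewrite big1 ?mul0r ?subr0 // => l _; rewrite mulr0.
have qy l : q (y l * u).
  apply: sub_q; exists (fun l' => (l' == l)%:R).
  rewrite (bigD1 l) //= eqxx mulr1 big1 => [|l' /negPf->]; last by rewrite mulr0.
  by rewrite addr0 subrr; apply: ideal0.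
have nil_y l : exists e, q (y l ^+ e).
  have [||e stab_e] := @ideal_chain_stable (fun e f => q (y l ^+ e * f)).
  - move=> e; split=> [|f g qf qg|f g qg]; first by rewrite mulr0; apply: ideal0.
      by rewrite mulrDr; apply: idealD.
    by rewrite mulrCA; apply: idealM.
  - by move=> e f qf; rewrite exprS -mulrA; apply: idealM.
  exists e; apply: NNPP => Nqy.
  pose J f := exists a, q (f - y l ^+ e * a).
  have idJ : is_ideal J.
    split=> [|f g [a qa] [b qb]|f g [a qa]].
    - by exists 0; rewrite mulr0 subrr; apply: ideal0.
    - by exists (a + b); rewrite mulrDr opprD addrACA; apply: idealD.
    - by exists (f * a); rewrite mulrCA -mulrBr; apply: idealM.
  have qJ f : q f -> J f by exists 0; rewrite mulr0 subr0.
  (* If [u] is not in [J] = q + (y^e), maximality gives J = q, which then contains y^e. Otherwise u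
     is y^e a modulo [q]; as y u lies in [q], so does y^(e+1) a, and stationarity puts y^e a, hence
     [u], in [q]. *)
  have [[a qa]|NJu] := classic (J u); last first.
    apply/Nqy/(max_q J) => //.
    by exists 1; rewrite mulr1 subrr; apply: ideal0.
  apply: Nqu; rewrite -[u](subrK (y l ^+ e * a)); apply: idealD => //.
  apply: stab_e.
  have -> : y l ^+ e.+1 * a = y l * u - y l * (u - y l ^+ e * a).
    by rewrite mulrBr opprB addrC subrK exprS mulrA.
  by apply: idealB => //; apply: idealM.
pose e l := sval (constructive_indefinite_description _ (nil_y l)).
have qe l : q (y l ^+ e l).
  exact: svalP (constructive_indefinite_description _ (nil_y l)).
pose em := \max_l e l.
apply: Nqu; apply: (@adic_sub I q y (N * em).+1) => // s sz_s.
apply: (@prod_pigeonhole q y em); rewrite ?sz_s //= => l.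
by rewrite -(subnK (leq_bigmax l : (e l <= em)%N)) exprD; apply: idealM.
Qed.

End Noether.

(** * Eigenvectors and Jordan decompositions *)

Lemma horner_mx_comp (R : comNzRingType) n (A : 'M[R]_n.+1) (p q : {poly R}) :
  horner_mx A (p \Po q) = horner_mx (horner_mx A q) p.
Proof.
elim/poly_ind: p => [|p c IHp]; first by rewrite comp_poly0 !rmorph0.
by rewrite comp_poly_MXaddC !rmorphD !rmorphM /= IHp horner_mx_X !horner_mx_C.
Qed.

Section JordanChevalley.
Variable k : closedFieldType.
Implicit Types (s : seq k) (F Q : {poly k}).

Lemma prod_XsubC_exp_dvdp s m F : uniq s ->
  (forall z, z \in s -> ('X - z%:P) ^+ m %| F) ->
  (\prod_(z <- s) ('X - z%:P)) ^+ m %| F.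
Proof.
elim: s => [|a s IHs] /=; first by rewrite big_nil expr1n dvd1p.
case/andP=> s'a uniq_s dvF; rewrite big_cons exprMn.
rewrite Gauss_dvdp ?dvF ?mem_head ?IHs // => [z s_z|].
  by rewrite dvF // inE s_z orbT.
have [->|m_gt0] := posnP m; first by rewrite expr0 coprime1p.
by rewrite coprimep_pexpl // coprimep_pexpr // coprimep_sym coprimep_XsubC root_prod_XsubC.
Qed.

Lemma chinese_XsubC s m : uniq s ->
  exists Q, forall z, z \in s -> ('X - z%:P) ^+ m %| Q - z%:P.
Proof.
elim: s => [|a s IHs] /=; first by exists 0.
case/andP=> s'a /IHs[Q dvQ].
have /Bezout_eq1_coprimepP[[u v] /= uv1] :
    coprimep (('X - a%:P) ^+ m) ((\prod_(z <- s) ('X - z%:P)) ^+ m).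
  have [->|m_gt0] := posnP m; first by rewrite expr0 coprime1p.
  by rewrite coprimep_pexpl // coprimep_pexpr // coprimep_sym coprimep_XsubC root_prod_XsubC.
set A := _ ^+ m in uv1; set B := _ ^+ m in uv1.
exists (a%:P * (v * B) + Q * (u * A)) => z; rewrite inE => /predU1P[->|s_z].
  have -> : a%:P * (v * B) + Q * (u * A) - a%:P = (Q - a%:P) * u * A.
    have -> : v * B = 1 - u * A by rewrite -uv1; ring.
    by ring.
  exact: dvdp_mull.
have -> : a%:P * (v * B) + Q * (u * A) - z%:P = (a%:P - Q) * v * B + (Q - z%:P).
  have -> : u * A = 1 - v * B by rewrite -uv1; ring.
  by ring.
rewrite dvdp_add ?dvQ // dvdp_mull // dvdp_exp2r //.
by rewrite (big_rem z) //= dvdp_mulr.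
Qed.

(** Take S = Q(X) with Q congruent to z modulo (x - z)^m at each eigenvalue z. The squarefree [p0]
    kills S because p0(Q) is divisible by p0^m, so S is diagonalizable; x - Q is divisible by [p0],
    so N = X - S is nilpotent. The degree m is large enough for p0^m to be a multiple of the
    characteristic polynomial. *)
Lemma jordan_chevalley_nonempty n (X : 'M[k]_n.+1) :
  exists S N P d, [/\ X = S + N, S * N = N * S, exists e, N ^+ e = 0,
    P \in unitmx & S = P *m diag_mx d *m invmx P].
Proof.
have [r def_p] := closed_field_poly_normal (char_poly X).
rewrite (monicP (char_poly_monic X)) scale1r in def_p.
pose s := undup r; pose m := size r.
have m_gt0 : (0 < m)%N.
  by have := size_char_poly X; rewrite def_p size_prod_XsubC /m => -[->].
pose p0 := \prod_(z <- s) ('X - z%:P).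
have uniq_s : uniq s by apply: undup_uniq.
have dv_p : char_poly X %| p0 ^+ m.
  rewrite def_p /m; have : {subset r <= s} by move=> z; rewrite mem_undup.
  elim: {1 2 3}r => [|z r' IHr sub_r]; first by rewrite big_nil dvd1p.
  rewrite big_cons /= exprS dvdp_mul // ?IHr // => [|x r'x].
    by rewrite /p0 (big_rem z) ?sub_r ?mem_head //= dvdp_mulr.
  by rewrite sub_r // inE r'x orbT.
have [Q dvQ] := chinese_XsubC m uniq_s.
have killX F : p0 ^+ m %| F -> horner_mx X F = 0.
  move/(dvdp_trans dv_p)/dvdpP=> [h ->].
  by rewrite rmorphM /= Cayley_Hamilton mulr0.
pose S := horner_mx X Q; pose N := horner_mx X ('X - Q).
have [P P_unit] : exists2 P : 'M[k]_n.+1, P \in unitmx & similar_diag P S.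
  apply/diagonalizableP; exists s => //; apply: mxminpoly_min.
  rewrite -horner_mx_comp killX // prod_XsubC_exp_dvdp // => z s_z.
  apply: dvdp_trans (dvQ z s_z) _.
  have /(dvdp_comp_poly Q) : 'X - z%:P %| p0.
    by rewrite /p0 (big_rem z) //= dvdp_mulr.
  by rewrite comp_polyB comp_polyX comp_polyC.
case/(diagonalizable_forLR P_unit) => d def_S.
have Pi_unit : invmx P \in unitmx by rewrite unitmx_inv.
rewrite mxpoly.conjumx // invmxK in def_S.
exists S, N, (invmx P), d; split=> //; last by rewrite invmxK.
- by rewrite -rmorphD /= addrC subrK horner_mx_X.
- by rewrite -!rmorphM mulrC.
exists m; rewrite /N -rmorphXn /= killX // dvdp_exp2r //.
rewrite -[p0]expr1 prod_XsubC_exp_dvdp // => z s_z; rewrite expr1.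
have -> : 'X - Q = ('X - z%:P) - (Q - z%:P) by rewrite opprB addrA subrK.
rewrite dvdp_sub //; apply: dvdp_trans (dvQ z s_z).
by rewrite -(prednK m_gt0) exprS dvdp_mulr.
Qed.

Lemma jordan_chevalley n (X : 'M[k]_n) :
  exists S N P d, [/\ X = S + N, S *m N = N *m S, exists e, N ^+ e = 0,
    P \in unitmx & S = P *m diag_mx d *m invmx P].
Proof.
case: n X => [|n] X; last exact: jordan_chevalley_nonempty.
exists 0, 0, 1%:M, 0; split; rewrite ?unitmx1 //.
- by apply/matrixP => -[].
- by exists 1%N; apply/matrixP => -[].
- by apply/matrixP => -[].
Qed.

End JordanChevalley.

Lemma row_subspace_basis (k : fieldType) m (V : 'rV[k]_m -> Prop) :
  V 0 -> (forall a u v, V u -> V v -> V (a *: u + v)) ->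
  exists B : 'M[k]_m, forall v, V v <-> (v <= B)%MS.
Proof.
move=> V0 VD.
have VZ a u : V u -> V (a *: u) by move=> Vu; rewrite -[_ *: u]addr0; apply: VD.
pose inV (B : 'M[k]_m) := forall v, (v <= B)%MS -> V v.
suff H j (B : 'M[k]_m) : inV B -> (m - \rank B <= j)%N ->
    exists B : 'M[k]_m, forall v, V v <-> (v <= B)%MS.
  by apply: (H m 0) => [v|]; rewrite ?submx0 ?leq_subr // => /eqP->.
elim: j B => [|j IHj] B VB le_j.
  exists B => v; split=> [_|]; last exact: VB.
  apply: submx_full; rewrite /row_full eqn_leq rank_leq_col /=.
  by rewrite -subn_eq0 -leqn0.
have [[v [Vv NBv]]|all_B] := classic (exists v, V v /\ ~~ (v <= B)%MS); last first.
  exists B => v; split=> [Vv|]; last exact: VB.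
  by apply/negPn/negP=> NBv; apply: all_B; exists v.
apply: (IHj (B + v)%MS) => [w /sub_addsmxP[[a b] ->] /=|].
  rewrite [b]mx11_scalar mul_scalar_mx addrC; apply: VD => //.
  by apply: VB; apply: submxMl.
have : (B < B + v)%MS by rewrite /ltmx addsmxSl addsmx_sub submx_refl.
rewrite ltmxErank => /andP[_ lt_B].
by rewrite -ltnS (leq_trans _ le_j) // ltn_sub2l // (leq_trans lt_B) // rank_leq_col.
Qed.

Lemma pchar0_mulrn_inj (k : fieldType) (a : k) : [pchar k] =i pred0 -> a != 0 ->
  injective (fun i => a *+ i).
Proof.
move=> /pcharf0P k0 nz_a; suff H i j : (i <= j)%N -> a *+ i = a *+ j -> i = j.
  by move=> i j; case/orP: (leq_total i j) => le_ij eq_ij; [|symmetry]; apply: H.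
move=> le_ij /eqP; rewrite eq_sym -subr_eq0 -mulrnBr // -mulr_natr mulf_eq0 (negPf nz_a) k0 /=.
by rewrite subn_eq0 => le_ji; apply/eqP; rewrite eqn_leq le_ij.
Qed.

Section EigenSplitting.
Variables (k : fieldType) (V : lmodType k).
Implicit Types (I : V -> Prop) (E S N : {linear V -> V}) (s : seq k) (p q : V).

Definition subspace I := I 0 /\ forall a p q, I p -> I q -> I (a *: p + q).

Lemma subspaceD I p q : subspace I -> I p -> I q -> I (p + q).
Proof. by case=> _ I_D; rewrite -[p in p + q]scale1r; apply: I_D. Qed.

Lemma subspaceZ I a p : subspace I -> I p -> I (a *: p).
Proof. by case=> I_0 I_D; rewrite -[a *: p]addr0 => Ip; apply: I_D. Qed.

Lemma subspaceB I p q : subspace I -> I p -> I q -> I (p - q).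
Proof. by case=> _ I_D Ip Iq; rewrite addrC -scaleN1r; apply: I_D. Qed.

Lemma subspace_sum I (T : eqType) (r : seq T) (F : T -> V) :
  subspace I -> (forall x, x \in r -> I (F x)) -> I (\sum_(x <- r) F x).
Proof.
move=> sI IF; rewrite big_seq; apply: big_ind => //; first by case: sI.
by move=> p q; apply: subspaceD.
Qed.

Definition eigen_sum E p :=
  exists2 l : seq (k * V), p = \sum_(x <- l) x.2 &
    forall x, x \in l -> E x.2 = x.1 *: x.2.

(* prod_(a in s) (E - a) *)
Definition eigen_prod E s p := foldr (fun a q => E q - a *: q) p s.

Lemma eigen_prodE E s p b : E p = b *: p ->
  eigen_prod E s p = (\prod_(a <- s) (b - a)) *: p.
Proof.
move=> Ep; elim: s => [|a s IHs] /=; first by rewrite big_nil scale1r.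
by rewrite IHs linearZ /= Ep !scalerA -scalerBl big_cons mulrBl [b * _]mulrC.
Qed.

Lemma eigen_prodB E s p q :
  eigen_prod E s (p - q) = eigen_prod E s p - eigen_prod E s q.
Proof.
elim: s => //= a s ->; rewrite linearB scalerBr /= !opprD !opprK.
by rewrite addrACA.
Qed.

Lemma eigen_prod_sum E s (T : eqType) (l : seq T) (F : T -> V) :
  (forall x, x \in l -> eigen_prod E s (F x) = 0) ->
  eigen_prod E s (\sum_(x <- l) F x) = 0.
Proof.
elim: l => [|x l IHl] H.
  by rewrite big_nil -[X in eigen_prod _ _ X](subrr 0) eigen_prodB subrr.
rewrite big_cons -[\sum_(y <- l) F y]opprK eigen_prodB H ?mem_head // sub0r.
rewrite -[- \sum_(_ <- _) _]sub0r eigen_prodB IHl ?subr0 => [|y l_y].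
  rewrite -[X in eigen_prod _ _ X](subrr 0) eigen_prodB subrr oppr0 //.
by rewrite H // inE l_y orbT.
Qed.

(** Induction on a list of distinct eigenvalues whose product of factors kills [p]. Applying all
    factors but the one of [a] gives an [a]-eigenvector in [I]; subtracting the multiple by [c^-1]
    leaves a vector killed by the other factors. *)
Lemma eigen_sum_stable E I p : subspace I -> (forall q, I q -> I (E q)) ->
  I p -> eigen_sum E p ->
  exists2 l : seq (k * V), p = \sum_(x <- l) x.2 &
    forall x, x \in l -> I x.2 /\ E x.2 = x.1 *: x.2.
Proof.
move=> sI IE Ip [l def_p El].
have kill_p : eigen_prod E (undup (map fst l)) p = 0.
  rewrite def_p; apply: eigen_prod_sum => x l_x; rewrite (eigen_prodE _ (El x l_x)).
  rewrite (big_rem x.1) ?mem_undup ?map_f //= subrr mul0r scale0r //.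
move: (undup_uniq (map fst l)) kill_p; move: (undup _) => s {l def_p El}.
elim: s p Ip => [|a s IHs] p Ip /= => [_ ->|/andP[s'a uniq_s] Eq].
  by exists [::] => //; rewrite big_nil.
pose q := eigen_prod E s p.
have Iq : I q.
  rewrite /q; elim: (s) => //= b s' IHs'.
  by apply: subspaceB; [|apply: IE|apply: subspaceZ].
have {}Eq : E q = a *: q by apply/eqP; rewrite -subr_eq0; apply/eqP.
pose c := \prod_(b <- s) (a - b).
have nz_c : c != 0.
  rewrite /c prodf_seq_neq0; apply/allP => b s_b /=; rewrite subr_eq0.
  by apply: contraNneq s'a => ->.
have [|//||l def_p Il] := IHs (p - c^-1 *: q).
- by apply: subspaceB => //; apply: subspaceZ.
- rewrite eigen_prodB (@eigen_prodE _ _ (c^-1 *: q) a); last first.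
    by rewrite linearZ /= Eq !scalerA mulrC.
  by rewrite scalerA -/c mulfV // scale1r -/q subrr.
exists ((a, c^-1 *: q) :: l) => [|x].
  by rewrite big_cons -def_p addrC subrK.
rewrite inE => /predU1P[->|/Il//] /=; split; first exact: subspaceZ.
by rewrite linearZ /= Eq !scalerA mulrC.
Qed.

Definition shift E (a : k) p := E p - a *: p.

(** This is coprimality of (E - a)^i and (E - b)^j modulo [I]. By induction on i + j both (E - a) p
    and (E - b) p lie in [I], and their difference is (b - a) p. *)
Lemma shift_coprime E I a b i j p : subspace I -> (forall q, I q -> I (E q)) ->
  a != b -> I (iter i (shift E a) p) -> I (iter j (shift E b) p) -> I p.
Proof.
move=> sI IE neq_ab.
have I_shift c q : I q -> I (shift E c q).
  by move=> Iq; apply: subspaceB; [|apply: IE|apply: subspaceZ].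
have shiftC c c' q : shift E c (shift E c' q) = shift E c' (shift E c q).
  rewrite /shift !linearB !linearZ /= !scalerA [c * _]mulrC.
  by rewrite addrACA.
have iterC c c' e q : shift E c (iter e (shift E c') q) = iter e (shift E c') (shift E c q).
  by elim: e => //= e IHe; rewrite shiftC IHe.
elim: {i j}(i + j)%N {-2}i {-2}j (leqnn (i + j)) p => [|m IHm] [|i] [|j] // le_m p Iip Ijp.
have Ia : I (shift E a p).
  apply: (IHm i j.+1) => //; first by rewrite -iterSr.
  by rewrite -iterC; apply: I_shift.
have Ib : I (shift E b p).
  apply: (IHm i.+1 j); first by rewrite addSnnS -ltnS -addSn.
    by rewrite -iterC; apply: I_shift.
  by rewrite -iterSr.
have : I ((b - a)^-1 *: (shift E a p - shift E b p)).
  by apply: subspaceZ => //; apply: subspaceB.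
rewrite /shift opprB [X in _ *: X]addrC addrA subrK -scalerBl scalerA mulVf ?scale1r //.
by rewrite subr_eq0 eq_sym.
Qed.

Lemma sum_undup_partition (l : seq (k * V)) :
  \sum_(x <- l) x.2 =
  \sum_(a <- undup (map fst l)) \sum_(x <- l | x.1 == a) x.2.
Proof.
rewrite (exchange_big_dep xpredT) //= big_seq [RHS]big_seq.
apply: eq_bigr => x l_x; rewrite -big_filter (_ : filter _ _ = [:: x.1]) ?big_seq1 //.
apply: perm_small_eq => //.
apply: uniq_perm; rewrite ?filter_uniq ?undup_uniq // => a.
rewrite mem_filter mem_undup inE eq_sym andb_idr // => /eqP->.
exact: map_f.
Qed.

(** [V] may be infinite-dimensional, so [N] need not be a polynomial in [E]. Instead, E - a acts as
    [N] on the [a]-eigenvectors of [S]: the components of [p] for [S] lie in [I], and [N] maps each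
    into [I]. With [I] the polynomials vanishing on a group this places nilpotent parts in the Lie
    algebra. *)
Lemma nilpotent_part_stable E S N I p :
  subspace I -> (forall q, I q -> I (E q)) ->
  (forall q, E q = S q + N q) -> (forall q, S (N q) = N (S q)) ->
  (forall q, exists e, iter e N q = 0) ->
  eigen_sum S p -> I p -> I (N p).
Proof.
move=> sI IE E_SN SNC Nnil [l def_p Sl] Ip.
have EN a q : S q = a *: q -> shift E a q = N q.
  by move=> Sq; rewrite /shift E_SN Sq addrC addKr.
have SN a e q : S q = a *: q -> S (iter e N q) = a *: iter e N q.
  by move=> Sq; elim: e => //= e IHe; rewrite SNC IHe linearZ.
have EN_iter a e q : S q = a *: q -> iter e (shift E a) q = iter e N q.
  by move=> Sq; elim: e => //= e ->; apply/EN/SN.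
have linT a e : exists T : {linear V -> V}, T =1 iter e (shift E a).
  elim: e => [|e [T defT]]; first by exists idfun.
  have linS : linear (fun q => shift E a (T q)).
    by move=> c u v; rewrite /shift !linearP /= addrACA -scalerDr.
  pose T' := GRing.isLinear.Build _ _ _ _ _ linS.
  by exists (HB.pack (fun q => shift E a (T q)) T' : {linear V -> V}) => q /=; rewrite defT.
(* A power [T] of E - b kills the component of [b], so induction puts the other T (q a) in [I].
   Since a power of E - a kills [q a], coprimality puts [q a] itself in [I]; the component of [b]
   follows by subtraction. *)
have key s (q : k -> V) : uniq s -> (forall a, a \in s -> S (q a) = a *: q a) ->
    I (\sum_(a <- s) q a) -> forall a, a \in s -> I (q a).
  elim: s q => //= b s IHs q /andP[s'b uniq_s] Sq; rewrite big_cons => Ibs.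
  have Sqb : S (q b) = b *: q b by rewrite Sq ?mem_head.
  have [e Ne] := Nnil (q b).
  have [T defT] := linT b e.
  have STC u : S (T u) = T (S u).
    rewrite !defT; elim: (e) => //= e' IHe'; rewrite /shift !linearB /= !E_SN !linearD /=.
    by rewrite linearZ /= SNC IHe'.
  have IT : forall a, a \in s -> I (T (q a)).
    apply: IHs => // [a s_a|]; first by rewrite STC Sq ?linearZ // inE s_a orbT.
    rewrite -linear_sum; have -> : \sum_(a <- s) q a = (q b + \sum_(a <- s) q a) - q b.
      by rewrite addrC addKr.
    rewrite linearB /= [T (q b)]defT EN_iter // Ne subr0 defT.
    elim: (e) => //= e' IHe'; apply: subspaceB => //; first exact: IE.
    exact: subspaceZ.
  have Is a : a \in s -> I (q a).
    move=> s_a; have Sqa : S (q a) = a *: q a by rewrite Sq // inE s_a orbT.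
    have [e' Ne'] := Nnil (q a).
    apply: (@shift_coprime E I a b e' e) => //; last by rewrite -defT; apply: IT.
      by apply: contraNneq s'b => <-.
    by rewrite EN_iter // Ne'; case: sI.
  move=> a; rewrite inE => /predU1P[->|/Is//].
  by rewrite -[q b](addrK (\sum_(a <- s) q a)); apply: subspaceB => //; apply: subspace_sum.
rewrite sum_undup_partition in def_p.
set s := undup _ in def_p; pose q a := \sum_(x <- l | x.1 == a) x.2.
have Sq a : S (q a) = a *: q a.
  rewrite /q linear_sum /= scaler_sumr; rewrite big_seq_cond [RHS]big_seq_cond.
  by apply: eq_bigr => x /andP[l_x /eqP<-]; apply: Sl.
have Iq a : a \in s -> I (q a).
  by apply: key (undup_uniq _) _ _ a; rewrite -?def_p.
rewrite def_p linear_sum; apply: subspace_sum => // a s_a.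
rewrite -/(q a) -(EN a) //; apply: subspaceB => //; last by apply: subspaceZ => //; apply: Iq.
exact/IE/Iq.
Qed.

End EigenSplitting.

(** * Invariant derivations *)

Section MatrixPolynomials.
Variables (k : fieldType) (n : nat).
Implicit Types (p q : {mpoly k[n * n]}) (a b g X Y : 'M[k]_n).

(** The target is general because matrices over [k] serve as points, matrices over k[t] as curves,
    and matrices over the polynomial ring as substitutions. *)
Definition mxev (R : comNzRingType) (f : {rmorphism k -> R}) (A : 'M[R]_n) :
    {mpoly k[n * n]} -> R :=
  mmap f (fun l => mxvec A 0 l).

HB.instance Definition _ (R : comNzRingType) (f : {rmorphism k -> R}) (A : 'M[R]_n) :=
  GRing.RMorphism.copy (mxev f A) (mxev f A).

Definition Xmx : 'M[{mpoly k[n * n]}]_n := vec_mx (\row_l 'X_l).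

Local Notation cmx := (map_mx (@mpolyC (n * n) k)).

Section Mxev.
Variables (R : comNzRingType) (f : {rmorphism k -> R}) (A : 'M[R]_n).

Lemma mxevC c : mxev f A c%:MP = f c.
Proof. exact: mmapC. Qed.

Lemma mxevX l : mxev f A 'X_l = mxvec A 0 l.
Proof. by rewrite /mxev mmapX mmap1U. Qed.

Lemma mxev_map_const a : map_mx (mxev f A) (cmx a) = map_mx f a.
Proof. by apply/matrixP => i j; rewrite !mxE /= mxevC. Qed.

Lemma mxev_Xmx : map_mx (mxev f A) Xmx = A.
Proof.
apply: (can_inj mxvecK); apply/rowP => l.
by rewrite -map_mxvec vec_mxK !mxE /= mxevX.
Qed.

End Mxev.

Lemma mxevalE p g : mxeval p g = mxev idfun g p.
Proof. by []. Qed.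

Lemma rmorph_mxev (R R' : comNzRingType) (f : {rmorphism k -> R})
    (h : {rmorphism R -> R'}) (f' : {rmorphism k -> R'}) A p :
  (forall c, h (f c) = f' c) -> h (mxev f A p) = mxev f' (map_mx h A) p.
Proof.
move=> hf; elim/mpoly_alg_ind: p => [c|l|p q IHp IHq|p q IHp IHq].
- by rewrite !mxevC.
- by rewrite !mxevX -map_mxvec mxE.
- by rewrite !rmorphD /= IHp IHq.
- by rewrite !rmorphM /= IHp IHq.
Qed.

Lemma horner_mxev (A : 'M[{poly k}]_n) p t :
  (mxev polyC A p).[t] = mxeval p (map_mx (horner_eval t) A).
Proof.
rewrite mxevalE -(rmorph_mxev (f := polyC) (h := horner_eval t)) // => c.
exact: hornerC.
Qed.

(* [x |-> p (a x b)] *)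
Definition translate a b : {mpoly k[n * n]} -> {mpoly k[n * n]} :=
  mxev (@mpolyC (n * n) k) (cmx a *m Xmx *m cmx b).

HB.instance Definition _ a b := GRing.RMorphism.copy (translate a b) (translate a b).

Lemma mxev_translate (R : comNzRingType) (f : {rmorphism k -> R}) (A : 'M[R]_n) a b p :
  mxev f A (translate a b p) = mxev f (map_mx f a *m A *m map_mx f b) p.
Proof.
rewrite (rmorph_mxev (f' := f)) => [|c]; last by rewrite /= mxevC.
by rewrite !map_mxM !mxev_map_const mxev_Xmx.
Qed.

Lemma mxeval_translate a b p g :
  mxeval (translate a b p) g = mxeval p (a *m g *m b).
Proof. by rewrite !mxevalE mxev_translate !map_mx_id. Qed.

Lemma map_translate_Xmx a b (B : 'M[k]_n) : map_mx (translate a b) (Xmx *m cmx B) =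
  cmx a *m Xmx *m cmx b *m cmx B.
Proof. by rewrite map_mxM mxev_Xmx mxev_map_const. Qed.

(* The left-invariant derivation: [invder X p] is the derivative of
   [p (x (1 + t X))] at [t = 0]. Locked to keep
   unification from unfolding it. *)
Fact invder_key : unit. Proof. exact: tt. Qed.
Definition invder : 'M[k]_n -> {mpoly k[n * n]} -> {mpoly k[n * n]} :=
  locked_with invder_key (fun X p => \sum_l mxvec (Xmx *m cmx X) 0 l * p^`M(l)).

Lemma invderE X p : invder X p = \sum_l mxvec (Xmx *m cmx X) 0 l * p^`M(l).
Proof. by rewrite /invder unlock. Qed.

Lemma invder_is_linear X : linear (invder X).
Proof.
move=> c p q; rewrite !invderE scaler_sumr -big_split /=; apply: eq_bigr => l _.
by rewrite mderivD mderivZ mulrDr scalerAr.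
Qed.

HB.instance Definition _ X :=
  GRing.isLinear.Build k {mpoly k[n * n]} {mpoly k[n * n]} *:%R (invder X) (invder_is_linear X).

Lemma invderM X p q : invder X (p * q) = invder X p * q + p * invder X q.
Proof.
rewrite !invderE mulr_suml mulr_sumr -big_split /=; apply: eq_bigr => l _.
by rewrite mderivM; ring.
Qed.

Lemma invderD X p q : invder X (p + q) = invder X p + invder X q.
Proof. exact: linearD. Qed.

Lemma invderC X c : invder X c%:MP = 0.
Proof. by rewrite invderE big1 // => l _; rewrite mderivC mulr0. Qed.

Lemma mderivXU l l' : ('X_l : {mpoly k[n * n]})^`M(l') = (l == l')%:R.
Proof.
rewrite mderivX mnm1E; have [->|_] := eqVneq; last by rewrite scale0r.
rewrite scale1r (_ : _ - _ = 0)%MM ?mpolyX0 //.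
by apply/mnmP => i; rewrite mnmBE mnm0E subnn.
Qed.

Lemma invderX X l : invder X 'X_l = mxvec (Xmx *m cmx X) 0 l.
Proof.
rewrite invderE (bigD1 l) //= mderivXU eqxx mulr1 big1 ?addr0 // => l' neq_l.
by rewrite mderivXU eq_sym (negPf neq_l) mulr0.
Qed.

Lemma map_invder_Xmx X (B : 'M[k]_n) : map_mx (invder X) (Xmx *m cmx B) = Xmx *m cmx X *m cmx B.
Proof.
apply/matrixP => i j; rewrite [LHS]mxE [in LHS]mxE [RHS]mxE linear_sum.
apply: eq_bigr => l _ /=; rewrite invderM [(cmx B) l j]mxE invderC mulr0 addr0; congr (_ * _).
by rewrite {1}/Xmx !mxE invderX mxvecE mxE.
Qed.

Lemma map_invder_mulC X a (A : 'M[{mpoly k[n * n]}]_n) :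
  map_mx (invder X) (cmx a *m A) = cmx a *m map_mx (invder X) A.
Proof.
apply/matrixP => i j; rewrite !mxE linear_sum; apply: eq_bigr => l _ /=.
by rewrite invderM [(cmx a) i l]mxE invderC mul0r add0r [in RHS]mxE.
Qed.

Lemma mxvecB (A B : 'M[{mpoly k[n * n]}]_n) l :
  mxvec (A - B) 0 l = mxvec A 0 l - mxvec B 0 l.
Proof. by rewrite linearB !mxE. Qed.

Lemma invder_mxvec X (A : 'M[{mpoly k[n * n]}]_n) l :
  invder X (mxvec A 0 l) = mxvec (map_mx (invder X) A) 0 l.
Proof. by rewrite -map_mxvec [RHS]mxE. Qed.

Lemma invder_lin X Y c p : invder (c *: X + Y) p = c *: invder X p + invder Y p.
Proof.
rewrite !invderE scaler_sumr -big_split /=; apply: eq_bigr => l _.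
rewrite scalerAl -mulrDl; congr (_ * _).
rewrite map_mxD map_mxZ mulmxDr -scalemxAr linearD linearZ /= !mxE.
by rewrite mul_mpolyC.
Qed.

Lemma invder0 p : invder 0 p = 0.
Proof. by have := invder_lin 0 0 (-1) p; rewrite scaler0 addr0 scaleN1r addNr. Qed.

Lemma invderZ c X p : invder (c *: X) p = c *: invder X p.
Proof. by rewrite -[c *: X]addr0 invder_lin invder0 addr0. Qed.

Lemma invder_sum (T : Type) (r : seq T) (P : pred T) (F : T -> 'M[k]_n) p :
  invder (\sum_(i <- r | P i) F i) p = \sum_(i <- r | P i) invder (F i) p.
Proof.
apply: (big_rec2 (fun A q => invder A p = q)) => [|i q A _ <-]; first exact: invder0.
by rewrite -[F i]scale1r invder_lin !scale1r.
Qed.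

Lemma mxeval_invder X p g :
  mxeval (invder X p) g = \sum_l mxvec (g *m X) 0 l * mxeval p^`M(l) g.
Proof.
rewrite mxevalE invderE rmorph_sum; apply: eq_bigr => l _; rewrite rmorphM /=.
congr (_ * _); rewrite -[mxvec _ 0 l]/(mxvec (Xmx *m cmx X) 0 l).
have -> : mxvec (g *m X) = map_mx (mxev idfun g) (mxvec (Xmx *m cmx X)).
  by rewrite map_mxvec map_mxM mxev_Xmx mxev_map_const map_mx_id.
by rewrite [RHS]mxE.
Qed.

(** This reduces the identities between [invder] and translations, brackets and curves to a check on
    the variables. *)
Lemma derivation_ext (R : comNzRingType) (f : {mpoly k[n * n]} -> R)
    (d1 d2 : {mpoly k[n * n]} -> R) :
  (forall c, d1 c%:MP = d2 c%:MP) -> (forall l, d1 'X_l = d2 'X_l) ->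
  {morph d1 : p q / p + q} -> {morph d2 : p q / p + q} ->
  (forall p q, d1 (p * q) = d1 p * f q + f p * d1 q) ->
  (forall p q, d2 (p * q) = d2 p * f q + f p * d2 q) -> d1 =1 d2.
Proof.
move=> eqC eqX d1D d2D d1M d2M; elim/mpoly_alg_ind => // p q IHp IHq.
  by rewrite d1D d2D IHp IHq.
by rewrite d1M d2M IHp IHq.
Qed.

(** Infinitesimally, a x (1 + t X) b = a x b (1 + t Y). The case b = 1 is left invariance; b = a^-1
    gives the adjoint action. *)
Lemma invder_translate a b X Y p : X *m b = b *m Y ->
  invder X (translate a b p) = translate a b (invder Y p).
Proof.
move=> XbY; apply: (derivation_ext (f := translate a b)
    (d1 := invder X \o translate a b) (d2 := translate a b \o invder Y)) p.
- by move=> c /=; rewrite invderC rmorph0 /translate mxevC invderC.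
- move=> l /=; rewrite invderX /translate mxevX -!/(translate a b _).
  rewrite invder_mxvec -mulmxA map_invder_mulC map_invder_Xmx.
  have -> : translate a b (mxvec (Xmx *m cmx Y) 0 l) =
      (map_mx (translate a b) (mxvec (Xmx *m cmx Y))) 0 l by rewrite [RHS]mxE.
  by rewrite map_mxvec map_translate_Xmx -!mulmxA -!map_mxM XbY.
- by move=> p q /=; rewrite rmorphD linearD.
- by move=> p q /=; rewrite linearD rmorphD.
- by move=> p q /=; rewrite rmorphM invderM.
- by move=> p q /=; rewrite invderM rmorphD !rmorphM.
Qed.

Lemma invder_invderX X Y l : invder X (invder Y 'X_l) = mxvec (Xmx *m cmx (X *m Y)) 0 l.
Proof. by rewrite (invderX Y l) invder_mxvec map_invder_Xmx map_mxM mulmxA. Qed.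

Lemma invder_commutator X Y p :
  invder X (invder Y p) - invder Y (invder X p) = invder (X *m Y - Y *m X) p.
Proof.
apply: (derivation_ext (f := id)
    (d1 := fun p => invder X (invder Y p) - invder Y (invder X p))
    (d2 := invder (X *m Y - Y *m X))) p.
- by move=> c; rewrite !invderC; apply: subr0.
- move=> l; rewrite (invder_invderX X Y) (invder_invderX Y X) (invderX _ l) -mxvecB -mulmxBr.
  congr (mxvec (Xmx *m _) 0 l); apply/esym/map_mxB.
- by move=> p q /=; rewrite !invderD opprD addrACA.
- exact: invderD.
- move=> p q; rewrite !(invderM, invderD).
  move: (invder X (invder Y p)) (invder Y (invder X p)).
  move: (invder X (invder Y q)) (invder Y (invder X q)).
  move: (invder X p) (invder Y p) (invder X q) (invder Y q) => x y z t c d a b.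
  by ring.
- exact: invderM.
Qed.

End MatrixPolynomials.

(** * Action of diagonalizable and nilpotent matrices on polynomials *)

Section EigenPolynomials.
Variables (k : fieldType) (n : nat).
Implicit Types (p q : {mpoly k[n * n]}) (X S N : 'M[k]_n).
Local Notation cmx := (map_mx (@mpolyC (n * n) k)).

Lemma eigen_sumD (V : lmodType k) (E : {linear V -> V}) (p q : V) :
  eigen_sum E p -> eigen_sum E q -> eigen_sum E (p + q).
Proof.
case=> lp -> Elp [lq -> Elq]; exists (lp ++ lq); first by rewrite big_cat.
by move=> x; rewrite mem_cat => /orP[/Elp|/Elq].
Qed.

Lemma eigen_sumM X p q :
  eigen_sum (invder X) p -> eigen_sum (invder X) q -> eigen_sum (invder X) (p * q).
Proof.
case=> lp -> Elp [lq -> Elq].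
exists [seq (x.1 + y.1, x.2 * y.2) | x <- lp, y <- lq].
  rewrite big_allpairs_dep mulr_suml; apply: eq_bigr => x _.
  by rewrite mulr_sumr.
move=> _ /allpairsP[[x y] [/= lp_x lq_y ->]] /=.
by rewrite invderM Elp // Elq // -scalerAl -scalerAr -scalerDl.
Qed.

Lemma eigen_sum_sum (V : lmodType k) (E : {linear V -> V}) (I : eqType) (r : seq I) a (F : I -> V) :
  (forall i, E (F i) = a i *: F i) -> eigen_sum E (\sum_(i <- r) F i).
Proof.
move=> EF; exists [seq (a i, F i) | i <- r]; first by rewrite big_map.
by move=> _ /mapP[i _ ->] /=.
Qed.

(** The entries of [Xmx *m P] are eigenvectors with eigenvalues from [d]. They generate the
    polynomial ring, and a product of eigenvectors is an eigenvector. *)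
Lemma eigen_sum_invder S P d p : P \in unitmx -> S = P *m diag_mx d *m invmx P ->
  eigen_sum (invder S) p.
Proof.
move=> P_unit def_S; elim/mpoly_alg_ind: p => [c|l|p q|p q].
- by exists [:: (0, c%:MP)] => [|x]; rewrite ?big_seq1 // inE => /eqP-> /=; rewrite invderC scale0r.
- case/mxvec_indexP: l => i j.
  have -> : 'X_(mxvec_index i j) = \sum_r (Xmx k n *m cmx P) i r * (invmx P r j)%:MP.
    transitivity ((Xmx k n *m cmx P *m cmx (invmx P)) i j).
      by rewrite -mulmxA -map_mxM mulmxV // map_mx1 mulmx1 /Xmx !mxE.
    by rewrite mxE; apply: eq_bigr => r _; rewrite [(cmx _) r j]mxE.
  apply: (@eigen_sum_sum _ _ _ _ (d 0)) => r /=.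
  have -> : invder S ((Xmx k n *m cmx P) i r * (invmx P r j)%:MP) =
      invder S ((Xmx k n *m cmx P) i r) * (invmx P r j)%:MP.
    by rewrite invderM invderC mulr0 addr0.
  have -> : invder S ((Xmx k n *m cmx P) i r) = (map_mx (invder S) (Xmx k n *m cmx P)) i r.
    by rewrite [RHS]mxE.
  rewrite map_invder_Xmx -mulmxA -map_mxM def_S mulmxKV // map_mxM mulmxA map_diag_mx mul_mx_diag.
  rewrite [(\matrix_(_, _) _) i r]mxE [(cmx d) 0 r]mxE.
  by rewrite [_ * (d 0 r)%:MP]mulrC mul_mpolyC -scalerAl.
- exact: eigen_sumD.
- exact: eigen_sumM.
Qed.

Lemma iter_invder_Xmx X e : map_mx (iter e (invder X)) (Xmx k n) = Xmx k n *m cmx (X ^+ e).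
Proof.
elim: e => [|e IHe]; first by rewrite map_mx_id // map_mx1 mulmx1.
have -> : map_mx (iter e.+1 (invder X)) (Xmx k n) =
    map_mx (invder X) (map_mx (iter e (invder X)) (Xmx k n)).
  by apply/matrixP => i j; rewrite !mxE.
by rewrite IHe map_invder_Xmx -mulmxA -map_mxM -[X *m _]/(X * X ^+ e) -exprS.
Qed.

Lemma invder_locally_nilpotent X e p : X ^+ e = 0 -> exists i, iter i (invder X) p = 0.
Proof.
move=> Xe; have iterD0 j : iter j (invder X) 0 = 0 by elim: j => //= j ->; rewrite linear0.
have iter0 i j q : iter i (invder X) q = 0 -> (i <= j)%N -> iter j (invder X) q = 0.
  by move=> q0 le_ij; rewrite -(subnK le_ij) iterD q0 iterD0.
elim/mpoly_alg_ind: p => [c|l|p q [i p0] [j q0]|p q [i p0] [j q0]].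
- by exists 1%N; rewrite /= invderC.
- exists e; case/mxvec_indexP: l => i j.
  transitivity ((map_mx (iter e (invder X)) (Xmx k n)) i j).
    by rewrite mxE /Xmx !mxE.
  by rewrite iter_invder_Xmx Xe map_mx0 mulmx0 mxE.
- exists (i + j)%N.
  have -> : iter (i + j) (invder X) (p + q) = iter (i + j) (invder X) p + iter (i + j) (invder X) q.
    by elim: (i + j)%N => //= m ->; rewrite invderD.
  by rewrite (iter0 i) ?leq_addr // (iter0 j) ?leq_addl // addr0.
(* With only an inequality on i + j, one application of the product rule suffices and binomial
   coefficients do not appear. *)
suff H m : forall i j p q, (i + j <= m)%N -> iter i (invder X) p = 0 ->
    iter j (invder X) q = 0 -> iter m (invder X) (p * q) = 0.
  by exists (i + j)%N; apply: (H _ i j).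
elim: m {i j p q p0 q0} => [|m IHm] i j p q.
  by rewrite leqn0 addn_eq0 => /andP[/eqP-> /eqP->] /= -> _; rewrite mul0r.
case: i => [|i] le_m.
  by move=> p0 _; rewrite (p0 : p = 0) mul0r iterD0.
case: j le_m => [|j] le_m.
  by move=> _ q0; rewrite (q0 : q = 0) mulr0 iterD0.
move=> p0 q0; rewrite iterSr invderM.
have iter_D u v : iter m (invder X) (u + v) = iter m (invder X) u + iter m (invder X) v.
  by elim: m {IHm le_m} => //= m ->; rewrite invderD.
rewrite iter_D (IHm i j.+1) ?(IHm i.+1 j) ?addr0 // -?iterSr //.
by rewrite addSnnS -ltnS -addSn.
Qed.

End EigenPolynomials.

(** * Exponentials of nilpotent matrices *)

Section Exponential.
Variables (k : closedFieldType) (n : nat).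
Hypothesis k_char0 : [pchar k] =i pred0.
Implicit Types (p q : {mpoly k[n * n]}) (X g : 'M[k]_n).

Lemma closed_poly_eq0 (f : {poly k}) : (forall t, f.[t] = 0) -> f = 0.
Proof.
move=> f0; apply/eqP/negPn/negP => /closed_nonrootP[t].
by rewrite rootE f0 eqxx.
Qed.

Lemma natr_fact_neq0 i : i`!%:R != 0 :> k.
Proof. by move/pcharf0P: k_char0 => ->; rewrite -lt0n fact_gt0. Qed.

(** The first [e] terms of exp (t X), which is all of it when X^e = 0. It is used with [e.+1] so
    that the term 1 is always present. *)
Definition expmx X e (t : k) : 'M[k]_n := \sum_(i < e) (i`!%:R^-1 * t ^+ i) *: X ^+ i.

Definition exp_curve X e : 'M[{poly k}]_n :=
  \sum_(i < e) (i`!%:R^-1 *: 'X^i) *: map_mx polyC (X ^+ i).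

Lemma horner_exp_curve X e t : map_mx (horner_eval t) (exp_curve X e) = expmx X e t.
Proof.
rewrite map_mx_sum; apply: eq_bigr => i _.
by apply/matrixP => r s; rewrite !mxE /= /horner_eval hornerM hornerZ hornerXn hornerC.
Qed.

Lemma deriv_exp_curve X e : X ^+ e = 0 ->
  map_mx deriv (exp_curve X e) = exp_curve X e *m map_mx polyC X.
Proof.
case: e => [|e] Xe; first by rewrite /exp_curve !big_ord0 map_mx0 mul0mx.
rewrite /exp_curve map_mx_sum big_ord_recl mulmx_suml big_ord_recr /=.
rewrite -scalemxAl -map_mxM -[X ^+ e *m X]/(X ^+ e * X) -exprSr Xe map_mx0 scaler0 addr0.
rewrite [X in X + _](_ : _ = 0) ?add0r; last first.
  by apply/matrixP => r s; rewrite !mxE expr0 derivM derivZ !derivC scaler0 mul0r mulr0 addr0.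
apply: eq_bigr => i _; rewrite -scalemxAl -map_mxM -[X ^+ i *m X]/(X ^+ i * X) -exprSr.
apply/matrixP => r s; rewrite !mxE derivM derivC mulr0 addr0 derivZ derivXn /=.
congr (_ * _); rewrite -scaler_nat scalerA factS natrM invfM mulrAC mulVf ?mul1r //.
by move/pcharf0P: k_char0 => ->.
Qed.

(** The chain rule along a curve with A' = A X, that is, an integral curve of [invder X]. *)
Lemma deriv_mxev (A : 'M[{poly k}]_n) X p : map_mx deriv A = A *m map_mx polyC X ->
  (mxev polyC A p)^`() = mxev polyC A (invder X p).
Proof.
move=> dA; apply: (derivation_ext (f := mxev polyC A)
    (d1 := fun p => (mxev polyC A p)^`()) (d2 := fun p => mxev polyC A (invder X p))) p => /=.
- by move=> c; rewrite mxevC derivC invderC rmorph0.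
- move=> l; rewrite mxevX invderX.
  have -> : mxev polyC A (mxvec (Xmx k n *m map_mx (@mpolyC (n * n) k) X) 0 l) =
     (map_mx (mxev polyC A) (mxvec (Xmx k n *m map_mx (@mpolyC (n * n) k) X))) 0 l.
    by rewrite [RHS]mxE.
  by rewrite map_mxvec map_mxM mxev_Xmx mxev_map_const -dA -map_mxvec [RHS]mxE.
- by move=> p q; rewrite rmorphD derivD.
- by move=> p q; rewrite invderD rmorphD.
- by move=> p q; rewrite rmorphM derivM.
- by move=> p q; rewrite invderM rmorphD !rmorphM.
Qed.

Lemma expmx0 X e : expmx X e.+1 0 = 1%:M.
Proof.
rewrite /expmx big_ord_recl big1 => [|i _]; last by rewrite expr0n mulr0 scale0r.
by rewrite fact0 invr1 mulr1 scale1r addr0.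
Qed.

Lemma unipotent_unitmx (M : 'M[k]_n) : unipotent M -> M \in unitmx.
Proof.
case=> e Me; rewrite -row_free_unit; apply: inj_row_free => v vM0.
have vM j : v *m (M - 1%:M) ^+ j = (-1) ^+ j *: v.
  elim: j => [|j IHj]; first by rewrite mulmx1 scale1r.
  rewrite exprSr -[_ * (M - _)]/(_ *m (M - _)) mulmxA IHj -scalemxAl mulmxBr vM0 mulmx1 sub0r.
  by rewrite exprS mulN1r scaleNr scalerN.
have := vM e; rewrite Me mulmx0 => /esym/eqP; rewrite scaler_eq0 signr_eq0 => /eqP-> //.
Qed.

Lemma expmx_unipotent X e t : X ^+ e = 0 -> unipotent (expmx X e.+1 t).
Proof.
move=> Xe; pose Y : 'M[k]_n := \sum_(i < e) (i.+1`!%:R^-1 * t ^+ i.+1) *: X ^+ i.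
have def_E : expmx X e.+1 t - 1%:M = X * Y.
  rewrite /expmx big_ord_recl /= fact0 invr1 mulr1 scale1r addrC addKr mulr_sumr.
  apply: eq_bigr => i _; rewrite [X ^+ _]exprS.
  exact: scalemxAr.
have XY : GRing.comm X Y.
  apply: commr_sum => i _.
  suff XC c : X *m (c *: X ^+ i) = (c *: X ^+ i) *m X by apply: XC.
  by rewrite -scalemxAr -scalemxAl; congr (_ *: _); apply: (commrX i (commr_refl X)).
by exists e; rewrite def_E exprMn_comm // Xe mul0r.
Qed.

End Exponential.

(** * The Lie algebra of a group of matrices *)

Section AdNilpotent.
Variables (k : fieldType) (n : nat).
Hypothesis k_char0 : [pchar k] =i pred0.
Implicit Types (S Y P : 'M[k]_n).

Definition bracket S Y : 'M[k]_n := S *m Y - Y *m S.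

Lemma bracket_is_linear S : linear (bracket S).
Proof.
move=> c X Y; rewrite /bracket mulmxDl mulmxDr -scalemxAr -scalemxAl scalerBr.
by rewrite opprD addrACA.
Qed.

HB.instance Definition _ S :=
  GRing.isLinear.Build k 'M[k]_n 'M[k]_n *:%R (bracket S) (bracket_is_linear S).

Variables (S P : 'M[k]_n) (d : 'rV[k]_n).
Hypotheses (P_unit : P \in unitmx) (def_S : S = P *m diag_mx d *m invmx P).

Lemma bracket_eigenE a Y : bracket S Y = a *: Y -> forall i j,
  (d 0 i - d 0 j - a) * (invmx P *m Y *m P) i j = 0.
Proof.
move=> eqY i j; set W := invmx P *m Y *m P.
have : diag_mx d *m W - W *m diag_mx d = a *: W.
  transitivity (invmx P *m (bracket S Y) *m P).
    rewrite /bracket mulmxBr mulmxBl def_S /W !mulmxA mulVmx // mul1mx.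
    by congr (_ - _); rewrite -!mulmxA mulVmx ?mulmx1.
  by rewrite eqY -scalemxAr -scalemxAl.
move/matrixP/(_ i j); rewrite mul_diag_mx mul_mx_diag !mxE => eqW.
by rewrite !mulrBl -eqW [_ * d 0 j]mulrC subrr.
Qed.

(** ad S is a derivation, so it multiplies Y^m by m a. Its eigenvalues are the finitely many
    differences d_i - d_j, while the m a are pairwise distinct; some Y^m is therefore 0. *)
Lemma bracket_eigen_nilpotent a Y : a != 0 -> bracket S Y = a *: Y ->
  exists e, Y ^+ e = 0.
Proof.
move=> nz_a eqY.
have eqYm m : bracket S (Y ^+ m) = (a *+ m) *: Y ^+ m.
  elim: m => [|m IHm].
    by rewrite scale0r /bracket mulmx1 mul1mx subrr.
  have -> : Y ^+ m.+1 = Y *m Y ^+ m by rewrite exprS.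
  have -> : bracket S (Y *m Y ^+ m) = bracket S Y *m Y ^+ m + Y *m bracket S (Y ^+ m).
    by rewrite /bracket mulmxBl mulmxBr !mulmxA addrA subrK.
  by rewrite eqY IHm -scalemxAl -scalemxAr -scalerDl mulrS.
pose l := [seq d 0 x.1 - d 0 x.2 | x : 'I_n * 'I_n].
have [m l'm] : exists m, a *+ m \notin l.
  apply: NNPP => l_all; pose s := [seq a *+ m | m <- iota 0 (size l).+1].
  have: (size s <= size l)%N.
    apply: uniq_leq_size => [|_ /mapP[m _ ->]].
      by rewrite map_inj_uniq ?iota_uniq //; apply: pchar0_mulrn_inj.
    by apply/negPn/negP => l'm; apply: l_all; exists m.
  by rewrite size_map size_iota ltnn.
exists m; have W0 : invmx P *m Y ^+ m *m P = 0.
  apply/matrixP => i j; have /eqP := bracket_eigenE (eqYm m) i j.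
  rewrite mulf_eq0 subr_eq0 => /orP[/eqP eq_m|/eqP->]; last by rewrite mxE.
  by case/negP: l'm; rewrite -eq_m; apply/imageP; exists (i, j).
by rewrite -[Y ^+ m](mulKVmx P_unit) -[invmx P *m _](mulmxK P_unit) W0 mul0mx mulmx0.
Qed.

Lemma eigen_sum_bracket Y : eigen_sum (bracket S) Y.
Proof.
pose W := invmx P *m Y *m P.
have -> : Y = \sum_(x : 'I_n * 'I_n) W x.1 x.2 *: (P *m delta_mx x.1 x.2 *m invmx P).
  rewrite -[LHS](mulKVmx P_unit) -[invmx P *m _](mulmxK P_unit) -/W.
  rewrite {1}[W]matrix_sum_delta pair_bigA /= mulmx_suml mulmx_sumr.
  by apply: eq_bigr => x _; rewrite -scalemxAl -scalemxAr mulmxA.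
apply: (@eigen_sum_sum _ _ _ _ _ (fun x => d 0 x.1 - d 0 x.2)) => -[i j] /=.
rewrite linearZ /= [RHS]scalerA [_ * W i j]mulrC -scalerA; congr (_ *: _).
have diagE : diag_mx d *m delta_mx i j - delta_mx i j *m diag_mx d =
    (d 0 i - d 0 j) *: delta_mx i j.
  apply/matrixP => r s; rewrite mul_diag_mx mul_mx_diag !mxE.
  have [->|_] := eqVneq r i; have [->|_] := eqVneq s j; rewrite /= ?mulr0 ?mul0r ?subr0 //.
  by rewrite mulr1 mul1r mulr1.
rewrite scalemxAl scalemxAr -diagE mulmxBr mulmxBl /bracket def_S !mulmxA.
by congr (_ - _); rewrite mulmxKV.
Qed.

End AdNilpotent.

Section GroupLie.
Variables (k : closedFieldType) (n : nat).
Hypothesis k_char0 : [pchar k] =i pred0.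
Variable G : 'M[k]_n -> Prop.
Hypothesis sG : is_subgroup G.
Implicit Types (p q : {mpoly k[n * n]}) (X Y g a b : 'M[k]_n).

Let G1 : G 1%:M. Proof. by case: sG. Qed.
Let GM a b : G a -> G b -> G (a *m b). Proof. by case: sG => _ _ H _; apply: H. Qed.
Let GV a : G a -> G (invmx a). Proof. by case: sG => _ _ _; apply. Qed.
Let GU a : G a -> a \in unitmx. Proof. by case: sG => H _ _ _; apply: H. Qed.

Definition vanish p := forall g, G g -> mxeval p g = 0.

Lemma mxeval0 g : mxeval (0 : {mpoly k[n * n]}) g = 0.
Proof. exact: meval0. Qed.
Lemma mxevalD p q g : mxeval (p + q) g = mxeval p g + mxeval q g.
Proof. exact: rmorphD. Qed.
Lemma mxevalB p q g : mxeval (p - q) g = mxeval p g - mxeval q g.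
Proof. exact: rmorphB. Qed.
Lemma mxevalM p q g : mxeval (p * q) g = mxeval p g * mxeval q g.
Proof. exact: rmorphM. Qed.
Lemma mxevalZ c p g : mxeval (c *: p) g = c * mxeval p g.
Proof. exact: mevalZ. Qed.
Lemma mxevalC c g : mxeval c%:MP g = c.
Proof. exact: mevalC. Qed.

Lemma vanish_ideal : is_ideal vanish.
Proof.
split=> [g _|p q Ip Iq g Gg|p q Iq g Gg]; first exact: mxeval0.
  by rewrite mxevalD (Ip g Gg) (Iq g Gg) addr0.
by rewrite mxevalM (Iq g Gg) mulr0.
Qed.

Lemma vanish_subspace : subspace vanish.
Proof.
split=> [g _|c p q Ip Iq g Gg]; first exact: mxeval0.
by rewrite mxevalD mxevalZ (Ip g Gg) (Iq g Gg) mulr0 addr0.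
Qed.

Lemma vanish_translate a b p : G a -> G b -> vanish p -> vanish (translate a b p).
Proof. by move=> Ga Gb Ip g Gg; rewrite mxeval_translate Ip //; apply/GM/Gb/GM. Qed.

(** The tangent space at the identity of the Zariski closure of [G]. *)
Definition lie X := forall p, vanish p -> mxeval (invder X p) 1%:M = 0.

Lemma mxeval_invder_translate X p g : mxeval (invder X p) g =
  mxeval (invder X (translate g 1%:M p)) 1%:M.
Proof.
by rewrite (@invder_translate _ _ g 1%:M X X) ?mulmx1 ?mul1mx // mxeval_translate !mulmx1.
Qed.

Lemma lie_invder X p : lie X -> vanish p -> vanish (invder X p).
Proof.
move=> gX Ip g Gg; rewrite mxeval_invder_translate; apply: gX.
exact: vanish_translate.
Qed.

Lemma lie_subspace : subspace lie.
Proof.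
split=> [p _|c X Y gX gY p Ip]; first by rewrite (invder0 p) mxeval0.
by rewrite invder_lin mxevalD mxevalZ (gX p Ip) (gY p Ip) mulr0 addr0.
Qed.

Lemma lie_bracket X Y : lie X -> lie Y -> lie (bracket X Y).
Proof.
move=> gX gY p Ip; rewrite -invder_commutator mxevalB.
by rewrite (gX _ (lie_invder gY Ip)) (gY _ (lie_invder gX Ip)) subr0.
Qed.

Lemma lie_conj g X : G g -> lie X -> lie (g *m X *m invmx g).
Proof.
move=> Gg gX p Ip.
have := gX _ (vanish_translate Gg (GV Gg) Ip).
rewrite (@invder_translate _ _ g (invmx g) X (g *m X *m invmx g)).
  by rewrite mxeval_translate mulmx1 mulmxV // GU.
by rewrite -mulmxA mulKmx // GU.
Qed.

Lemma lie_nilpotent_part S N P d e : P \in unitmx ->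
  S = P *m diag_mx d *m invmx P -> S *m N = N *m S -> N ^+ e = 0 ->
  lie (S + N) -> lie N.
Proof.
move=> P_unit def_S SN Ne gSN p Ip.
apply: (@nilpotent_part_stable _ _ (invder (S + N)) (invder S) (invder N) vanish) => //.
- exact: vanish_subspace.
- by move=> q; apply: lie_invder.
- by move=> q; have := invder_lin S N 1 q; rewrite !scale1r.
- move=> q; apply/eqP; rewrite -subr_eq0; apply/eqP.
  by rewrite invder_commutator SN subrr invder0.
- by move=> q; apply: invder_locally_nilpotent Ne.
- exact: eigen_sum_invder def_S.
Qed.

Lemma poly_derivn0_eq0 (f : {poly k}) : (forall m, (f^`(m)).[0] = 0) -> f = 0.
Proof.
move=> f0; apply/polyP => m; have := f0 m; rewrite horner_coef0 coef_derivn addn0 ffactnn.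
rewrite -mulr_natr coef0 => /eqP; rewrite mulf_eq0 (negPf (natr_fact_neq0 k_char0 m)) orbF.
by move/eqP.
Qed.

(** The m-th derivative of p (exp (t X)) at t = 0 is the value at 1 of the m-fold [invder X] of [p],
    which still vanishes on [G]. In characteristic 0 this makes the polynomial in t zero. *)
Lemma lie_expmx X e t p : lie X -> X ^+ e = 0 -> vanish p ->
  mxeval p (expmx X e.+1 t) = 0.
Proof.
move=> gX Xe Ip; rewrite -horner_exp_curve -horner_mxev.
suff -> : mxev polyC (exp_curve X e.+1) p = 0 by rewrite horner0.
apply: poly_derivn0_eq0 => m.
have dE q : (mxev polyC (exp_curve X e.+1) q)^`() = mxev polyC (exp_curve X e.+1) (invder X q).
  by apply: deriv_mxev; apply: deriv_exp_curve; rewrite // exprS Xe mulr0.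
have -> : (mxev polyC (exp_curve X e.+1) p)^`(m) =
    mxev polyC (exp_curve X e.+1) (iter m (invder X) p).
  by elim: m => // m IHm; rewrite derivnS IHm dE.
rewrite horner_mxev horner_exp_curve expmx0.
suff: vanish (iter m (invder X) p) by apply.
by elim: m => //= m; apply: lie_invder.
Qed.

(** Decompose [Y] into ad S-eigenvectors, which stay in the Lie algebra because it is stable under
    ad S. The bracket multiplies each by its eigenvalue: the result is 0 or nilpotent. *)
Lemma lie_bracket_nilpotents S P d Y : P \in unitmx ->
  S = P *m diag_mx d *m invmx P -> lie S -> lie Y ->
  exists2 l : seq 'M[k]_n, bracket S Y = \sum_(Z <- l) Z &
    forall Z, Z \in l -> lie Z /\ exists e, Z ^+ e = 0.
Proof.
move=> P_unit def_S gS gY.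
have [l def_Y Yl] := eigen_sum_stable lie_subspace (fun Z : 'M[k]_n => @lie_bracket S Z gS) gY
  (eigen_sum_bracket P_unit def_S Y).
exists [seq x.1 *: x.2 | x <- l].
  rewrite big_map {1}def_Y linear_sum /= big_seq [RHS]big_seq.
  by apply: eq_bigr => x /Yl[].
move=> _ /mapP[x /Yl[gx Sx] ->]; split.
  exact: (subspaceZ x.1 lie_subspace gx).
have [->|nz_x] := eqVneq x.1 0; first by exists 1%N; rewrite scale0r.
have [e xe] := bracket_eigen_nilpotent k_char0 P_unit def_S nz_x Sx.
exists e; suff -> : (x.1 *: x.2) ^+ e = x.1 ^+ e *: x.2 ^+ e by rewrite xe scaler0.
elim: {xe}e => [|m IHm]; first by rewrite scale1r.
have -> : (x.1 *: x.2) ^+ m.+1 = (x.1 *: x.2) *m (x.1 *: x.2) ^+ m by rewrite exprS.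
by rewrite IHm -scalemxAl -scalemxAr scalerA -exprS [x.2 ^+ m.+1]exprS.
Qed.

End GroupLie.

(** * Powers of an ideal and Taylor expansion at the identity *)

Section Adic.
Variables (k : fieldType) (N : nat) (I : {mpoly k[N]} -> Prop).
Variable y : 'I_N -> {mpoly k[N]}.
Hypothesis idI : is_ideal I.
Implicit Types f g : {mpoly k[N]}.

Lemma adic_incl r f : I f -> adic I y r f.
Proof.
elim: r f => //= r IHr f If; exists (fun=> 0); split=> [l|]; first by apply: IHr; apply: ideal0.
by rewrite big1 ?subr0 // => l _; rewrite mulr0.
Qed.

Lemma adic_ideal r : is_ideal (adic I y r).
Proof.
elim: r => [|r IHr] //=; split=> [|f g [a [ad_a Ia]] [b [ad_b Ib]]|f g [a [ad_a Ia]]].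
- exact: (adic_incl r.+1 (ideal0 idI)).
- exists (fun l => a l + b l); split=> [l|]; first exact: idealD.
  under eq_bigr do rewrite mulrDr.
  by rewrite big_split opprD addrACA; apply: idealD.
exists (fun l => f * a l); split=> [l|]; first exact: idealM.
under eq_bigr do rewrite mulrCA.
by rewrite -mulr_sumr -mulrBr; apply: idealM.
Qed.

Lemma adic_mulX r l f : adic I y r f -> adic I y r.+1 (y l * f).
Proof.
move=> ad_f; exists (fun l' => if l' == l then f else 0); split=> [l'|].
  by case: ifP => // _; apply: ideal0; apply: adic_ideal.
rewrite (bigD1 l) //= eqxx big1 => [|l' /negPf->]; last by rewrite mulr0.
by rewrite addr0 subrr; apply: ideal0.
Qed.

Lemma adicM r s f g : adic I y r f -> adic I y s g -> adic I y (r + s) (f * g).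
Proof.
elim: r f => [|r IHr] f; first by move=> _; apply: idealM; apply: adic_ideal.
case=> a [ad_a If] ad_g; rewrite addSn -[f](subrK (\sum_l y l * a l)) mulrDl.
apply: idealD; first exact: adic_ideal.
  by apply: adic_incl; apply: idealMr.
rewrite mulr_suml; apply: ideal_sum => [|l _]; first exact: adic_ideal.
by rewrite -mulrA; apply: adic_mulX; apply: IHr => //; apply: ad_a.
Qed.

End Adic.

Section Taylor.
Variables (k : closedFieldType) (n : nat) (I : {mpoly k[n * n]} -> Prop).
Hypothesis idI : is_ideal I.
Implicit Types p q : {mpoly k[n * n]}.

Lemma mxeval_sum (T : Type) (r : seq T) (P : pred T) (F : T -> {mpoly k[n * n]}) g :
  mxeval (\sum_(i <- r | P i) F i) g = \sum_(i <- r | P i) mxeval (F i) g.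
Proof. exact: (rmorph_sum (mxev idfun g)). Qed.

(** These generate the maximal ideal m of the identity matrix, so [adic I coord1 r] is I + m^r. *)
Definition coord1 (l : 'I_(n * n)) : {mpoly k[n * n]} := 'X_l - (mxvec (1%:M : 'M[k]_n) 0 l)%:MP.

Lemma mxeval_coord1 l : mxeval (coord1 l) 1%:M = 0.
Proof. by rewrite mxevalB mxevalC mxevalE mxevX subrr. Qed.

Lemma mxeval_deriv_coord1 l l' g : mxeval (coord1 l)^`M(l') g = (l == l')%:R.
Proof. by rewrite mderivB mderivC mderivXU subr0; apply: (rmorph_nat (mxev idfun g)). Qed.

Lemma taylor1 p : exists a, p = (mxeval p 1%:M)%:MP + \sum_l coord1 l * a l.
Proof.
elim/mpoly_alg_ind: p => [c|l|p q [a def_p] [b def_q]|p q [a def_p] [b def_q]].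
- exists (fun=> 0); rewrite mxevalC big1 ?addr0 // => l _; exact: mulr0.
- exists (fun l' => (l' == l)%:R); rewrite (bigD1 l) //= eqxx mulr1 big1 => [|l' /negPf->].
    by rewrite addr0 mxevalE mxevX /coord1 addrC subrK.
  exact: mulr0.
- exists (fun l => a l + b l); under eq_bigr do rewrite mulrDr.
  by rewrite big_split mxevalD mpolyCD addrACA /= -def_p -def_q.
exists (fun l => a l * q + (mxeval p 1%:M)%:MP * b l).
have -> : \sum_l coord1 l * (a l * q + (mxeval p 1%:M)%:MP * b l) =
    (\sum_l coord1 l * a l) * q + (mxeval p 1%:M)%:MP * \sum_l coord1 l * b l.
  rewrite mulr_suml mulr_sumr -big_split /=; apply: eq_bigr => l _.
  by rewrite mulrDr mulrA [coord1 l * (_ * b l)]mulrCA.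
rewrite mxevalM mpolyCM addrCA -mulrDr -def_q addrC -mulrDl -def_p //.
Qed.

Lemma adic1_mxeval p : mxeval p 1%:M = 0 -> adic I coord1 1 p.
Proof.
move=> p0; have [a def_p] := taylor1 p; exists a; split=> //.
by rewrite {1}def_p p0 mpolyC0 add0r subrr; apply: ideal0.
Qed.

Lemma taylor2 p : adic I coord1 2
  (p - (mxeval p 1%:M)%:MP - \sum_l coord1 l * (mxeval p^`M(l) 1%:M)%:MP).
Proof.
have [a def_p] := taylor1 p.
have -> : p - (mxeval p 1%:M)%:MP = \sum_l coord1 l * a l by rewrite {1}def_p addrC addKr.
rewrite -sumrB; apply: ideal_sum => [|l _]; first exact: adic_ideal.
rewrite -mulrBr; apply: adic_mulX => //; apply: adic1_mxeval.
rewrite mxevalB mxevalC {1}def_p mderivD mderivC add0r.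
rewrite (raddf_sum (mderiv l)) /= mxeval_sum (bigD1 l) //= big1 => [|l' neq_l].
  rewrite mderivM mxevalD !mxevalM mxeval_coord1 mul0r addr0.
  by rewrite mxeval_deriv_coord1 eqxx mul1r addr0 subrr.
rewrite mderivM mxevalD !mxevalM mxeval_coord1 mul0r addr0.
by rewrite mxeval_deriv_coord1 (negPf neq_l) mul0r.
Qed.

End Taylor.

Arguments coord1 {k n} l.

(** * Eigenfunctions of the Lie algebra and the characters they define *)

Section Eigenfunctions.
Variables (k : closedFieldType) (n : nat).
Hypothesis k_char0 : [pchar k] =i pred0.
Variable G : 'M[k]_n -> Prop.
Hypotheses (sG : is_subgroup G) (G_connected : zariski_connected G).
Implicit Types (p q u w : {mpoly k[n * n]}) (X Y g h : 'M[k]_n).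

Local Notation I := (vanish G).
Local Notation adicI := (adic I (@coord1 k n)).
Local Notation idI := (vanish_ideal G).

Let G1 : G 1%:M. Proof. by case: sG. Qed.
Let GM a b : G a -> G b -> G (a *m b). Proof. by case: sG => _ _ H _; apply: H. Qed.
Let GV a : G a -> G (invmx a). Proof. by case: sG => _ _ _; apply. Qed.
Let GU a : G a -> a \in unitmx. Proof. by case: sG => H _ _ _; apply: H. Qed.

Definition grad1 p : 'rV[k]_(n * n) := \row_l mxeval p^`M(l) 1%:M.

Lemma mxeval_invder1 X p : mxeval (invder X p) 1%:M = \sum_l mxvec X 0 l * grad1 p 0 l.
Proof. by rewrite mxeval_invder mul1mx; apply: eq_bigr => l _; rewrite mxE. Qed.

Lemma lie_basis : exists B : 'M[k]_(n * n), forall X, lie G X <-> (mxvec X <= B)%MS.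
Proof.
have [||B BP] := @row_subspace_basis k (n * n) (fun v => lie G (vec_mx v)).
- by rewrite linear0; apply: (lie_subspace G).1.
- by move=> a u v gu gv; rewrite linearP; apply: (lie_subspace G).2.
by exists B => X; rewrite -BP mxvecK.
Qed.

(* The duality between the Lie algebra and the cotangent space [m / m^2]. *)
Lemma cotangent_dual (v : 'rV[k]_(n * n)) :
  (forall X, lie G X -> v *m (mxvec X)^T = 0) -> exists2 p, I p & grad1 p = v.
Proof.
move=> v0.
have [|a _ _ [p Ip <-] [q Iq <-]|C CP] :=
    @row_subspace_basis k (n * n) (fun v => exists2 p, I p & grad1 p = v).
- exists 0; first exact: ideal0 idI.
  by apply/rowP => l; rewrite !mxE mderiv0 mxeval0.
- exists (a *: p + q); first exact: (vanish_subspace G).2.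
  by apply/rowP => l; rewrite !mxE mderivD mderivZ mxevalD mxevalZ.
apply/CP; rewrite submxE; apply/eqP/rowP => j; rewrite [RHS]mxE.
(* A column of the cokernel pairs to 0 with all gradients, hence belongs to the Lie algebra. By
   hypothesis [v] kills it too, which puts [v] in the span of the gradients. *)
pose X : 'M[k]_n := vec_mx (col j (cokermx C))^T.
have gX : lie G X.
  move=> p Ip; rewrite mxeval_invder1 vec_mxK.
  have /CP : exists2 q, I q & grad1 q = grad1 p by exists p.
  rewrite submxE => /eqP/rowP/(_ j); rewrite !mxE => Cj0; rewrite -[RHS]Cj0.
  by apply: eq_bigr => l _; rewrite !mxE mulrC.
have /rowP/(_ 0) := v0 X gX; rewrite vec_mxK trmxK !mxE => vX0; rewrite -[RHS]vX0.
by apply: eq_bigr => l _; rewrite [in RHS]mxE.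
Qed.

(* Subtracting the projection onto the Lie algebra leaves functionals which
   vanish on it, hence the Euler operator [\sum_i t_i invder X_i] is the identity
   on [m / m^2]. *)
Lemma euler_coordinates : exists (Xs : 'I_(n * n) -> 'M[k]_n) (t : 'I_(n * n) -> {mpoly k[n * n]}),
  [/\ forall i, lie G (Xs i), forall i, adicI 1 (t i) &
      forall l, adicI 2 (\sum_i t i * invder (Xs i) (coord1 l) - coord1 l)].
Proof.
have [B BP] := lie_basis; pose c := pinvmx B.
pose Xs i : 'M[k]_n := vec_mx (row i B).
pose t i : {mpoly k[n * n]} := \sum_l coord1 l * (c l i)%:MP.
have t1 i : adicI 1 (t i).
  apply: ideal_sum => [|l _]; first by apply: adic_ideal; apply: idI.
  by apply: adic_mulX; first exact: idI.
exists Xs, t; split=> [i||l] //; first by rewrite BP vec_mxK row_sub.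
pose Z : 'M[k]_(n * n) := 1%:M - c *m B.
(* [c *m B] fixes the row space of [B], so the columns of [Z] kill the Lie algebra. Each is thus the
   gradient of some [p] vanishing on [G], and its linear form lies in I + m^2. *)
have [p Ip grad_p] : exists2 p, I p & grad1 p = (col l Z)^T.
  apply: cotangent_dual => X /BP/mulmxKpV Xc.
  rewrite -trmx_mul; have -> : mxvec X *m col l Z = col l (mxvec X *m Z).
    by rewrite !colE mulmxA.
  by rewrite mulmxBr mulmx1 mulmxA Xc subrr raddf0 trmx0.
have Z2 : adicI 2 (\sum_l' coord1 l' * (Z l' l)%:MP).
  have := taylor2 idI p; rewrite (Ip _ G1) mpolyC0 subr0 => p2.
  have -> : \sum_l' coord1 l' * (Z l' l)%:MP =
      p - (p - \sum_l' coord1 l' * (mxeval p^`M(l') 1%:M)%:MP).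
    rewrite opprB addrC subrK; apply: eq_bigr => l' _; congr (_ * _%:MP).
    by have /rowP/(_ l') := grad_p; rewrite !mxE => ->.
  by apply: idealB => //; [apply: adic_ideal; apply: idI|exact: (adic_incl coord1 idI 2 Ip)].
have DXs i : adicI 1 (invder (Xs i) (coord1 l) - (B i l)%:MP).
  apply: adic1_mxeval; first exact: idI.
  rewrite mxevalB mxevalC mxeval_invder1 vec_mxK (bigD1 l) //= big1 => [|l' neq_l].
    by rewrite !mxE mxeval_deriv_coord1 eqxx mulr1 addr0 subrr.
  by rewrite !mxE mxeval_deriv_coord1 eq_sym (negPf neq_l) mulr0.
have -> : \sum_i t i * invder (Xs i) (coord1 l) - coord1 l =
    \sum_i t i * (invder (Xs i) (coord1 l) - (B i l)%:MP) - \sum_l' coord1 l' * (Z l' l)%:MP.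
  under [in RHS]eq_bigr do rewrite mulrBr.
  rewrite sumrB -addrA -opprD; congr (_ - _).
  have -> : \sum_i t i * (B i l)%:MP = \sum_l' coord1 l' * ((c *m B) l' l)%:MP.
    under eq_bigr do rewrite mulr_suml.
    rewrite exchange_big; apply: eq_bigr => l' _ /=.
    rewrite mxE raddf_sum mulr_sumr; apply: eq_bigr => i _.
    by rewrite -mulrA -mpolyCM.
  rewrite -big_split /= (bigD1 l) //= big1 => [|l' neq_l].
    by rewrite -mulrDr -mpolyCD !mxE eqxx mulr1n addrCA subrr !addr0 mpolyC1 mulr1.
  by rewrite -mulrDr -mpolyCD !mxE (negPf neq_l) mulr0n addrCA subrr addr0 mpolyC0 mulr0.
apply: idealB => //; first by apply: adic_ideal; apply: idI.
apply: ideal_sum => [|i _]; first by apply: adic_ideal; apply: idI.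
exact: (@adicM _ _ _ _ idI 1 1).
Qed.

Definition eigenfunction w := forall X, lie G X -> exists a, I (invder X w - a *: w).

(* If [u] is an eigenfunction and [u 1 = 0], the Euler operator [E] satisfies
   [E u = tau u] with [tau] in [m], while [E] is multiplication by [r] on
   [m^r / m^(r+1)]; hence [u] lies in every power of [m]. *)
Lemma eigenfunction_adic u r : eigenfunction u -> mxeval u 1%:M = 0 -> adicI r u.
Proof.
move=> eig_u u1; have [Xs [t [gXs t1 Ey]]] := euler_coordinates.
pose E p := \sum_i t i * invder (Xs i) p.
have idA s := adic_ideal (@coord1 k n) idI s.
have ED : {morph E : p q / p + q}.
  move=> p q; rewrite /E -big_split /=; apply: eq_bigr => i _.
  by rewrite invderD mulrDr.
have EM p q : E (p * q) = E p * q + p * E q.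
  rewrite /E mulr_suml mulr_sumr -big_split /=; apply: eq_bigr => i _.
  by rewrite invderM; move: (invder _ p) (invder _ q) => x z; ring.
have EI p : I p -> I (E p).
  move=> Ip; rewrite /E; apply: (ideal_sum _ idI) => i _.
  by apply: (idealM _ idI); apply: lie_invder.
have E_sum (F : 'I_(n * n) -> {mpoly k[n * n]}) : E (\sum_l F l) = \sum_l E (F l).
  rewrite /E exchange_big /=; apply: eq_bigr => i _.
  by rewrite linear_sum mulr_sumr.
have Er s v : adicI s v -> adicI s.+1 (E v - v *+ s).
  elim: s v => [|s IHs] v.
    move=> _; rewrite subr0; apply: ideal_sum => [|i _]; first exact: (idA 1%N).
    by apply: idealMr; [exact: (idA 1%N)|exact: t1].
  case=> a [ad_a Iva]; pose v1 := \sum_l coord1 l * a l.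
  have -> : E v - v *+ s.+1 = (E (v - v1) - (v - v1) *+ s.+1) +
      \sum_l ((E (coord1 l) - coord1 l) * a l + coord1 l * (E (a l) - a l *+ s)).
    have -> : \sum_l ((E (coord1 l) - coord1 l) * a l + coord1 l * (E (a l) - a l *+ s)) =
        E v1 - v1 *+ s.+1.
      rewrite /v1 E_sum -sumrMnl -sumrB; apply: eq_bigr => l _.
      by rewrite EM mulrBl mulrBr mulrnAr mulrS opprD addrACA.
    by rewrite addrACA -ED -opprD -mulrnDl subrK.
  apply: idealD; first exact: (idA s.+2).
    apply: adic_incl; first exact: idI.
    apply: (idealB idI); first exact: EI.
    by rewrite -scaler_nat; apply: (idealZ _ idI).
  apply: ideal_sum => [|l _]; first exact: (idA s.+2).
  apply: idealD; first exact: (idA s.+2).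
    exact: (adicM idI (r := 2) (s := s) (Ey l) (ad_a l)).
  by apply: adic_mulX; [exact: idI|apply: IHs; apply: ad_a].
have [a Ia] : exists a, forall i, I (invder (Xs i) u - a i *: u).
  have ex_a i := eig_u (Xs i) (gXs i).
  exists (fun i => sval (constructive_indefinite_description _ (ex_a i))) => i.
  exact: svalP (constructive_indefinite_description _ (ex_a i)).
pose tau := \sum_i a i *: t i.
have tau1 : adicI 1 tau.
  apply: ideal_sum => [|i _]; first exact: (idA 1%N).
  by apply: idealZ; [exact: (idA 1%N)|exact: t1].
have Eu : I (E u - tau * u).
  rewrite /E /tau mulr_suml -sumrB; apply: (ideal_sum _ idI) => i _.
  rewrite -scalerAl scalerAr -mulrBr; apply: (idealM _ idI).
  exact: Ia.
(* The induction starts at exponent 1, where the hypothesis on the value at 1 enters, because each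
   step divides by the exponent. *)
case: r => [//|r]; elim: r => [|r IHr]; first by apply: adic1_mxeval; [exact: idI|].
have rnz : r.+1%:R != 0 :> k by move/pcharf0P: k_char0 => ->.
have -> : u = r.+1%:R^-1 *: (u *+ r.+1).
  by rewrite -scaler_nat scalerA mulVf // scale1r.
apply: idealZ; first exact: (idA r.+2).
have -> : u *+ r.+1 = (E u - tau * u) + tau * u - (E u - u *+ r.+1).
  by rewrite subrK opprB addrC subrK.
apply: idealB; first exact: (idA r.+2).
  apply: idealD; first exact: (idA r.+2).
    by apply: adic_incl; first exact: idI.
  exact: (adicM idI (r := 1) (s := r.+1) tau1 IHr).
exact: Er.
Qed.

Lemma eigenfunction_translate g w : G g -> eigenfunction w ->
  eigenfunction (translate g 1%:M w).
Proof.
move=> Gg eig_w X gX; have [a Ia] := eig_w X gX; exists a.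
rewrite (@invder_translate _ _ g 1%:M X X) ?mulmx1 ?mul1mx //.
have -> : a *: translate g 1%:M w = translate g 1%:M (a *: w).
  by rewrite -!mul_mpolyC rmorphM /= /translate mxevC.
by rewrite -rmorphB; apply: vanish_translate.
Qed.

(** After translating [h] to 1, Krull gives u = b u on [G] with b in the maximal ideal; [s] is 1 - b
    translated back. Where [s] is nonzero, [w] vanishes on [G]. *)
Lemma eigenfunction_zero_nbhd w h : eigenfunction w -> G h -> mxeval w h = 0 ->
  exists s, mxeval s h = 1 /\ I (s * w).
Proof.
move=> eig_w Gh wh0; pose u := translate h 1%:M w.
have eig_u : eigenfunction u by apply: eigenfunction_translate.
have u1 : mxeval u 1%:M = 0 by rewrite mxeval_translate !mulmx1.
have [b Ib] := krull_intersection idI (fun r => eigenfunction_adic r eig_u u1).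
pose s0 := 1 - \sum_l coord1 l * b l.
have s01 : mxeval s0 1%:M = 1.
  rewrite mxevalB mxeval_sum big1 => [|l _]; last by rewrite mxevalM mxeval_coord1 mul0r.
  by rewrite subr0; apply: meval1.
exists (translate (invmx h) 1%:M s0); split=> [|g Gg].
  by rewrite mxeval_translate mulmx1 mulVmx // GU.
have := Ib (invmx h *m g) (GM (GV Gh) Gg).
rewrite -{1}[u]mul1r -mulrBl -/s0 mxevalM {1}/u !mxeval_translate !mulmx1 mulKVmx ?GU //.
by rewrite mxevalM mxeval_translate mulmx1.
Qed.

(* The zero set of an eigenfunction is open and closed in [G]. *)
Lemma eigenfunction_zero w h : eigenfunction w -> G h -> mxeval w h = 0 -> I w.
Proof.
move=> eig_w Gh wh0 g Gg.
(* Within [G], the closed set [C2] cut out by these [s] is exactly the complement of the zero set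
   [C1]: each [s] kills [w] on [G], and at every zero some [s] is 1. *)
pose P s := exists2 h', G h' & [/\ mxeval w h' = 0, mxeval s h' = 1 & I (s * w)].
pose C1 M := mxeval w M = 0; pose C2 M := forall s, P s -> mxeval s M = 0.
have C1_closed : zariski_closed C1.
  by exists (eq^~ w) => M; split=> [wM p ->|]; [|apply].
have C2_closed : zariski_closed C2 by exists P.
have [//|wg0] := classic (mxeval w g = 0).
have in_C2 M : G M -> mxeval w M <> 0 -> C2 M.
  move=> GM' wM s [h' _ [_ _ Isw]]; have /eqP := Isw M GM'.
  by rewrite mxevalM mulf_eq0 => /orP[/eqP//|/eqP].
have [|||M GM' [wM C2M]] := G_connected C1_closed C2_closed.
- by move=> M GM'; have [|/in_C2] := classic (mxeval w M = 0); [left|right; auto].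
- by exists h.
- by exists g => //; apply: in_C2.
have [s [sM Isw]] := eigenfunction_zero_nbhd eig_w GM' wM.
have /eqP := C2M s (ex_intro2 _ _ M GM' (And3 wM sM Isw)).
by rewrite sM oner_eq0.
Qed.

Lemma eigenfunction_char w : eigenfunction w -> ~ I w ->
  exists2 chi, is_character G chi &
    forall g x, G g -> G x -> mxeval w (g *m x) = chi g * mxeval w x.
Proof.
move=> eig_w Nw.
have [h Gh wh] : exists2 h, G h & mxeval w h != 0.
  apply: NNPP => no_h; apply: Nw => g Gg; apply: NNPP => wg; apply: no_h.
  by exists g => //; apply/eqP.
pose chi g := mxeval w (g *m h) / mxeval w h.
have chiP g x : G g -> G x -> mxeval w (g *m x) = chi g * mxeval w x.
  (* [u] has the same eigenvalues as [w], and [chi g] is chosen to make it vanish at [h]; so it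
     vanishes on [G]. *)
  move=> Gg Gx; pose u := translate g 1%:M w - chi g *: w.
  have eig_u : eigenfunction u.
    move=> X gX; have [a Ia] := eig_w X gX; exists a.
    have -> : invder X u - a *: u =
        translate g 1%:M (invder X w - a *: w) - chi g *: (invder X w - a *: w).
      rewrite /u linearB linearZ /= (@invder_translate _ _ g 1%:M X X) ?mulmx1 ?mul1mx //.
      have -> : translate g 1%:M (invder X w - a *: w) =
          translate g 1%:M (invder X w) - a *: translate g 1%:M w.
        by rewrite rmorphB /= -!mul_mpolyC rmorphM /= /translate mxevC.
      by rewrite !scalerBr !opprD !opprK !scalerA [a * _]mulrC addrACA.
    apply: (idealB idI); first exact: vanish_translate.
    by apply: (idealZ _ idI).
  have : mxeval u x = 0.
    apply: (eigenfunction_zero eig_u Gh) => //.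
    by rewrite mxevalB mxevalZ mxeval_translate mulmx1 divfK // subrr.
  by rewrite mxevalB mxevalZ mxeval_translate mulmx1 => /eqP; rewrite subr_eq0 => /eqP.
exists chi => //; have chiM a b : G a -> G b -> chi (a *m b) = chi a * chi b.
  by move=> Ga Gb; rewrite /chi -mulmxA chiP ?mulrA //; apply: GM.
have chi1 : chi 1%:M = 1 by rewrite /chi mul1mx divff.
split=> // [|g Gg].
  exists ((mxeval w h)^-1 *: translate 1%:M h w), 0%N => g Gg.
  by rewrite expr0 divr1 mxevalZ mxeval_translate mul1mx mulrC.
apply/eqP => chig; have /eqP := chiM _ _ Gg (GV Gg).
by rewrite mulmxV ?GU // chi1 chig mul0r oner_eq0.
Qed.

(** Stated axiomatically, so that the induction on matrices can replace [W] by an eigenspace inside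
    it. *)
Definition unipotent_invariants (W : {mpoly k[n * n]} -> Prop) :=
  [/\ subspace W, forall X p, lie G X -> W p -> W (invder X p) &
      forall Z e p, lie G Z -> Z ^+ e = 0 -> W p -> I (invder Z p)].

(** Write X = S + N. The element [p] splits into [S]-eigenvectors within [W], and on [W] the
    operators of X and S agree modulo [I]. Each component lies in the eigenspace [Wa], to which the
    induction hypothesis applies. *)
Lemma simultaneous_eigen (Xs : seq 'M[k]_n) W p : unipotent_invariants W ->
  (forall X, X \in Xs -> lie G X) -> W p ->
  exists2 l : seq {mpoly k[n * n]}, p = \sum_(q <- l) q &
    forall q, q \in l -> W q /\ forall X, X \in Xs -> exists a, I (invder X q - a *: q).
Proof.
elim: Xs W p => [|X Xs IHXs] W p invW gXs Wp.
  by exists [:: p]; rewrite ?big_seq1 // => q; rewrite inE => /eqP->.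
have [sW W_D W_nil] := invW.
have gX : lie G X by apply: gXs; apply: mem_head.
have [S [N [P [d [def_X SN [e Ne] P_unit def_S]]]]] := jordan_chevalley X.
have gN : lie G N by apply: (lie_nilpotent_part sG P_unit def_S SN Ne); rewrite -def_X.
have gS : lie G S.
  rewrite -[S](addrK N) -def_X.
  exact: (subspaceB (lie_subspace G) gX gN).
have [l def_p Wl] := eigen_sum_stable sW (fun q => @W_D S q gS) Wp
  (eigen_sum_invder p P_unit def_S).
have DXE q : invder X q = invder S q + invder N q.
  by have := invder_lin S N 1 q; rewrite !scale1r -def_X.
pose Wa a q := W q /\ I (invder X q - a *: q).
have inv_Wa a : unipotent_invariants (Wa a).
  split.
  - split; first by split; [case: sW|rewrite linear0 scaler0 subr0; apply: (ideal0 idI)].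
    move=> c q q' [Wq Iq] [Wq' Iq']; split; first by case: sW => _; apply.
    have -> : invder X (c *: q + q') - a *: (c *: q + q') =
        c *: (invder X q - a *: q) + (invder X q' - a *: q').
      rewrite linearP scalerDr scalerBr !scalerA [a * c]mulrC opprD.
      by rewrite addrACA.
    by apply: (vanish_subspace G).2.
  - move=> Y q gY [Wq Iq]; split; first exact: W_D.
    (* Stability under [Y] requires [X, Y] to map [q] into [I]: [S, Y] is a sum of nilpotent
       elements of the Lie algebra, and in [N, Y] both products contain [N]. *)
    have -> : invder X (invder Y q) - a *: invder Y q =
        invder Y (invder X q - a *: q) + invder (bracket X Y) q.
      rewrite -invder_commutator [invder Y (_ - _)]linearB /= [invder Y (a *: _)]linearZ /=.
      by rewrite [RHS]addrC addrA subrK.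
    apply: (idealD idI); first exact: lie_invder.
    have -> : invder (bracket X Y) q =
        invder (bracket S Y) q + (invder N (invder Y q) - invder Y (invder N q)).
      rewrite invder_commutator; have := invder_lin (bracket S Y) (N *m Y - Y *m N) 1 q.
      rewrite !scale1r => <-; congr (invder _ q).
      by rewrite /bracket def_X mulmxDl mulmxDr opprD addrACA.
    apply: (idealD idI).
      have [r -> Zr] := lie_bracket_nilpotents k_char0 sG P_unit def_S gS gY.
      rewrite invder_sum big_seq; apply: (ideal_sum _ idI).
      by move=> Z /Zr[gZ [e' Ze]]; apply: W_nil Ze Wq.
    apply: (idealB idI).
      by apply: W_nil Ne _ => //; apply: W_D.
    by apply: lie_invder => //; apply: W_nil Ne Wq.
  - by move=> Z e' q gZ Ze [Wq _]; apply: W_nil Ze Wq.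
have split_x x : x \in l -> exists2 l' : seq {mpoly k[n * n]}, x.2 = \sum_(q <- l') q &
    forall q, q \in l' -> W q /\ forall Y, Y \in X :: Xs -> exists a, I (invder Y q - a *: q).
  move=> l_x; have [Wx Sx] := Wl x l_x.
  have Wax : Wa x.1 x.2.
    by split=> //; rewrite DXE Sx addrC addKr; apply: W_nil Ne Wx.
  have [|l' def_x l'P] := IHXs _ _ (inv_Wa x.1) _ Wax.
    by move=> Y XsY; apply: gXs; rewrite inE XsY orbT.
  exists l' => // q /l'P[[Wq Iq] eig_q]; split=> // Y; rewrite inE => /predU1P[->|/eig_q//].
  by exists x.1.
elim: l p def_p split_x {Wp Wl} => [|x l IHl] p -> split_x.
  by exists [::]; rewrite ?big_nil.
have [|l1 def_l l1P] := IHl _ erefl.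
  by move=> y l_y; apply: split_x; rewrite inE l_y orbT.
have [l2 def_x l2P] := split_x x (mem_head _ _).
exists (l2 ++ l1); first by rewrite big_cons big_cat def_x def_l.
by move=> q; rewrite mem_cat => /orP[/l2P|/l1P].
Qed.

Lemma unipotent_invariants_char_kernel W p g : unipotent_invariants W -> W p ->
  char_kernel G g -> mxeval p g = mxeval p 1%:M.
Proof.
move=> invW Wp [Gg chi_g]; have [B BP] := lie_basis.
pose Xs := [seq vec_mx (row i B) : 'M[k]_n | i <- enum 'I_(n * n)].
have [|l def_p lP] := simultaneous_eigen invW _ Wp (Xs := Xs).
  by move=> _ /mapP[i _ ->]; rewrite BP vec_mxK row_sub.
rewrite def_p !mxeval_sum big_seq [RHS]big_seq; apply: eq_bigr => q /lP[_ eig_q].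
have [Iq|NIq] := classic (I q); first by rewrite !Iq.
have [|chi chiG chiP] := eigenfunction_char _ NIq; last first.
  by rewrite -{1}[g]mulmx1 chiP // chi_g // mul1r.
move=> X /BP/submxP[c def_X].
have {}def_X : X = \sum_i c 0 i *: vec_mx (row i B).
  apply: (can_inj mxvecK); rewrite def_X linear_sum mulmx_sum_row.
  by apply: eq_bigr => i _; rewrite linearZ /= vec_mxK.
have ex_a i : exists a, I (invder (vec_mx (row i B)) q - a *: q).
  by apply: eig_q; apply: map_f; rewrite mem_enum.
pose a i := sval (constructive_indefinite_description _ (ex_a i)).
have Ia i : I (invder (vec_mx (row i B)) q - a i *: q).
  exact: svalP (constructive_indefinite_description _ (ex_a i)).
exists (\sum_i c 0 i * a i); rewrite def_X invder_sum scaler_suml -sumrB.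
apply: (ideal_sum _ idI) => i _.
by rewrite invderZ -scalerA -scalerBr; apply: (idealZ _ idI); apply: Ia.
Qed.

End Eigenfunctions.

(** * Closed subgroups and characters *)

Section Chevalley.
Variables (k : closedFieldType) (n : nat).
Implicit Types (p : {mpoly k[n * n]}) (g h u x : 'M[k]_n).

(** This bounds the rank of all matrices with entries p (y_j h_i), that is, the dimension of the
    span of the right translates of [p]. *)
Lemma mxeval_mul_finite_rank p : exists l : seq (('M[k]_n -> k) * ('M[k]_n -> k)),
  forall x h, mxeval p (x *m h) = \sum_(f <- l) f.1 x * f.2 h.
Proof.
elim/mpoly_alg_ind: p => [c|i|p q [lp def_p] [lq def_q]|p q [lp def_p] [lq def_q]].
- by exists [:: (fun=> c, fun=> 1)] => x h; rewrite big_seq1 /= mulr1 mxevalC.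
- case/mxvec_indexP: i => i j.
  exists [seq (fun x : 'M[k]_n => x i r, fun h : 'M[k]_n => h r j) | r <- enum 'I_n] => x h.
  by rewrite mxevalE mxevX mxvecE mxE big_map big_enum.
- by exists (lp ++ lq) => x h; rewrite mxevalD def_p def_q big_cat.
exists [seq (fun x => f.1 x * f'.1 x, fun h => f.2 h * f'.2 h) | f <- lp, f' <- lq] => x h.
rewrite mxevalM def_p def_q big_allpairs_dep mulr_suml; apply: eq_bigr => f _ /=.
by rewrite mulr_sumr; apply: eq_bigr => f' _ /=; rewrite mulrACA.
Qed.

Lemma subst_col_det d (A A' : 'M[k]_d) j :
  (forall i j', j' != j -> A' i j' = A i j') ->
  \det A' = (\adj A *m col j A') j 0.
Proof.
move=> eqA; rewrite (expand_det_col _ j) mxE; apply: eq_bigr => i _.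
rewrite !mxE mulrC /cofactor; congr (_ * \det _ * _).
by apply/matrixP => r s; rewrite !mxE eqA // eq_sym neq_lift.
Qed.

(* The functions of the conclusion are the coordinates, in the exterior power
   of the polynomial functions, of a line with stabilizer [N]: they are the
   maximal minors of the right translates of [p] by [N]. *)
Lemma chevalley (N : 'M[k]_n -> Prop) p : is_subgroup N -> vanish N p ->
  exists (F : {mpoly k[n * n]} -> Prop) (c : 'M[k]_n -> k),
  [/\ forall f x u, F f -> N u -> mxeval f (x *m u) = c u * mxeval f x,
      exists2 f, F f & mxeval f 1%:M != 0 &
      forall g, (forall f, F f -> mxeval f g = mxeval f 1%:M) -> mxeval p g = 0].
Proof.
case=> _ N1 NM _ Np.
pose A d (y h : 'I_d -> 'M[k]_n) : 'M[k]_d := \matrix_(i, j) mxeval p (y j *m h i).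
pose P d := exists y h : 'I_d -> 'M[k]_n, (forall i, N (h i)) /\ @A d y h \in unitmx.
have [l rank_l] := mxeval_mul_finite_rank p.
have P_le d : P d -> (d <= size l)%N.
  case=> y [h [_]]; rewrite -row_full_unit => /eqP{1}<-.
  pose f0 : ('M[k]_n -> k) * ('M[k]_n -> k) := (fun=> 0, fun=> 0).
  pose L : 'M[k]_(d, size l) := \matrix_(i, r) (nth f0 l r).2 (h i).
  pose R : 'M[k]_(size l, d) := \matrix_(r, j) (nth f0 l r).1 (y j).
  have -> : A d y h = L *m R.
    apply/matrixP => i j; rewrite !mxE rank_l (big_nth f0) big_mkord.
    by apply: eq_bigr => r _; rewrite !mxE mulrC.
  by rewrite (leq_trans (mxrankM_maxl _ _)) // rank_leq_col.
(* With [d] maximal, the translates of [p] by the [h i] form a basis of the span of all translates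
   by [N], and the points [y j] separate its elements. *)
have [d [[y [h [Nh A_unit]]] NPd]] : exists d, P d /\ ~ P (d + 1)%N.
  apply: NNPP => no_d; suff /P_le : P (size l).+1 by rewrite ltnn.
  elim: (size l).+1 => [|d Pd].
    exists (fun=> 0), (fun=> 0); split; first by case.
    by rewrite unitmxE det_mx00 unitr1.
  by apply: NNPP => NPd; apply: no_d; exists d; rewrite addn1.
pose c x : 'rV[k]_d := (\row_j mxeval p (y j *m x)) *m invmx (A d y h).
have cP u x : N u -> mxeval p (x *m u) = \sum_i c u 0 i * mxeval p (x *m h i).
  (* Appending the point [x] and the element [u] gives a singular matrix by maximality; its Schur
     complement, p (x u) minus the claimed expansion, must vanish. *)
  move=> Nu; pose y' (j : 'I_(d + 1)) := if split j is inl j' then y j' else x.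
  pose h' (i : 'I_(d + 1)) := if split i is inl i' then h i' else u.
  have : \det (A _ y' h') = 0.
    apply/eqP/negPn; rewrite -unitfE -unitmxE; apply/negP => A'_unit; apply: NPd.
    by exists y', h'; split=> // i; rewrite /h'; case: (split i).
  pose q : 'cV[k]_d := \col_i mxeval p (x *m h i).
  pose r : 'rV[k]_d := \row_j mxeval p (y j *m u).
  have -> : A _ y' h' = block_mx 1%:M 0 (c u) 1%:M *m
      block_mx (A d y h) q 0 ((mxeval p (x *m u))%:M - c u *m q).
    rewrite mulmx_block !mul1mx !mul0mx !addr0 addrC subrK /c mulmxKV //.
    apply/matrixP => i j; rewrite !mxE /y' /h'.
    by case: (split i) => i'; rewrite !mxE; case: (split j) => j'; rewrite !mxE ?ord1 ?mulr1n.
  rewrite det_mulmx det_lblock det_ublock !det1 !mul1r => /eqP.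
  rewrite mulf_eq0 -[_ == 0](negbK) -unitfE -unitmxE A_unit /= det_mx11 !mxE eqxx mulr1n.
  by rewrite subr_eq0 => /eqP->; apply: eq_bigr => i _; rewrite [q _ _]mxE.
pose f (z : 'I_d -> 'M[k]_n) : {mpoly k[n * n]} := \det (\matrix_(i, j) translate (z j) (h i) p).
have fE z x : mxeval (f z) x = \det (A d (fun j => z j *m x) h).
  rewrite mxevalE /f -det_map_mx; congr (\det _); apply/matrixP => i j.
  by rewrite !mxE; apply: mxeval_translate.
pose C u : 'M[k]_d := \matrix_(i, l) c (u *m h i) 0 l.
exists (fun q => exists z, q = f z), (fun u => \det (C u)); split.
- move=> _ x u [z ->] Nu; rewrite !fE -det_mulmx; congr (\det _).
  apply/matrixP => i j; rewrite !mxE -!mulmxA mulmxA cP; last exact: NM.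
  by apply: eq_bigr => r _; rewrite !mxE.
- exists (f y); first by exists y.
  rewrite fE -unitfE -unitmxE (_ : A d _ h = A d y h) //.
  by apply/matrixP => i j; rewrite !mxE mulmx1.
move=> g eq_f.
pose Q := A d (fun j => y j *m g) h.
have detQ : \det Q = \det (A d y h).
  rewrite -fE eq_f; last by exists y.
  by rewrite fE; congr (\det _); apply/matrixP => i j; rewrite !mxE mulmx1.
pose v x : 'cV[k]_d := \col_i mxeval p (x *m h i).
(* By Cramer's rule, row [j] compares the minors at g and at 1 with [y j] replaced by [x]. At x = 1
   the right side is 0, since [p] vanishes on [N]; hence v g = 0, and p (g) is a combination of its
   entries. *)
have adj_eq x : \adj Q *m v (x *m g) = \adj (A d y h) *m v x.
  apply/colP => j; pose z j' := if j' == j then x else y j'.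
  have : mxeval (f z) g = mxeval (f z) 1%:M by apply: eq_f; exists z.
  rewrite !fE (@subst_col_det _ Q _ j) => [|i j' /negPf neq_j]; last first.
    by rewrite !mxE /z neq_j.
  rewrite (@subst_col_det _ (A d y h) _ j) => [|i j' /negPf neq_j]; last first.
    by rewrite !mxE /z neq_j mulmx1.
  have -> : col j (A d (fun j => z j *m g) h) = v (x *m g).
    by apply/colP => i; rewrite !mxE /z eqxx.
  have -> // : col j (A d (fun j => z j *m 1%:M) h) = v x.
  by apply/colP => i; rewrite !mxE /z eqxx mulmx1.
have v1 : v 1%:M = 0 by apply/colP => i; rewrite !mxE mul1mx Np.
have vg : v g = 0.
  have := adj_eq 1%:M; rewrite v1 mulmx0 mul1mx => /(congr1 (mulmx Q)).
  rewrite mulmxA mul_mx_adj mul_scalar_mx detQ mulmx0 => /eqP.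
  rewrite scaler_eq0 -[_ == 0](negbK) -unitfE -unitmxE A_unit /=.
  by move/eqP.
rewrite -[g]mulmx1 cP // big1 // => i _.
by have /colP/(_ i) := vg; rewrite !mxE => ->; rewrite mulr0.
Qed.

End Chevalley.

(** * The identity component is a connected closed subgroup *)

Section IdentityComponent.
Variables (k : closedFieldType) (n : nat).
Implicit Types (H A C S : 'M[k]_n -> Prop) (g M : 'M[k]_n).

Lemma zariski_closed_translate C g : zariski_closed C ->
  zariski_closed (fun M => C (g *m M)).
Proof.
case=> P CP; exists (fun q => exists2 p, P p & q = translate g 1%:M p) => M.
rewrite CP; split=> [gM _ [p Pp ->]|gM p Pp].
  by rewrite mxeval_translate mulmx1 gM.
by have := gM _ (ex_intro2 _ _ p Pp erefl); rewrite mxeval_translate mulmx1.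
Qed.

Lemma zariski_connected_translate A g : g \in unitmx -> zariski_connected A ->
  zariski_connected (fun M => A (invmx g *m M)).
Proof.
move=> g_unit A_conn C1 C2 C1_closed C2_closed cover [M1 AM1 CM1] [M2 AM2 CM2].
have [|||M AM [CM1' CM2']] := A_conn _ _ (zariski_closed_translate g C1_closed)
    (zariski_closed_translate g C2_closed).
- by move=> M AM; apply: cover; rewrite mulKmx.
- by exists (invmx g *m M1); rewrite ?mulKVmx.
- by exists (invmx g *m M2); rewrite ?mulKVmx.
- by exists (g *m M); rewrite ?mulKmx.
Qed.

Lemma id_component_sub H : subset_of (id_component H) H.
Proof. by move=> M [A [_ AH _ AM]]; apply: AH. Qed.

Lemma id_component_connected H : zariski_connected (id_component H).
Proof.
move=> C1 C2 C1_closed C2_closed cover [x1 Hx1 C1x1] [x2 Hx2 C2x2].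
have H1 : id_component H 1%:M.
  by have [A [A_conn AH A1 _]] := Hx1; exists A.
have meet x C C' : zariski_closed C -> zariski_closed C' ->
    (forall M, id_component H M -> C M \/ C' M) ->
    id_component H x -> C x -> C' 1%:M -> exists2 M, id_component H M & C M /\ C' M.
  move=> C_closed C'_closed cov [A [A_conn AH A1 Ax]] Cx C'1.
  have AHo M : A M -> id_component H M by move=> AM; exists A.
  have [|||M AM CM] := A_conn C C' C_closed C'_closed.
  - by move=> M /AHo/cov.
  - by exists x.
  - by exists 1%:M.
  - by exists M => //; apply: AHo.
have [C1_1|C2_1] := cover _ H1; last exact: (meet x1).
have [M HM []] : exists2 M, id_component H M & C2 M /\ C1 M; last by exists M.
by apply: (meet x2) => // M /cover[]; [right|left].
Qed.

Lemma id_component_subgroup H : is_subgroup H -> is_subgroup (id_component H).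
Proof.
case=> HU H1 HM HV.
have Ho1 : id_component H 1%:M.
  exists (eq 1%:M); split=> // [|M <- //].
  move=> C1 C2 _ _ cover [M <- C1M] [M' <- C2M].
  by exists 1%:M.
have divH a b : id_component H a -> id_component H b -> id_component H (invmx a *m b).
  move=> Ha Hb; have a_unit : a \in unitmx by apply/HU/(id_component_sub Ha).
  (* This is the translate of the component by a^-1: connected, and containing 1 because [a] is in
     the component. *)
  exists (fun M => id_component H (invmx (invmx a) *m M)); split.
  - apply: zariski_connected_translate; first by rewrite unitmx_inv.
    exact: id_component_connected.
  - move=> M; rewrite invmxK => /id_component_sub HaM.
    rewrite -[M](mulKmx a_unit); apply: HM => //.
    by apply/HV/(id_component_sub Ha).
  - by rewrite mulmx1 invmxK.
  - by rewrite invmxK mulKVmx.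
have VH a : id_component H a -> id_component H (invmx a).
  by move=> Ha; rewrite -[invmx a]mulmx1; apply: divH.
split=> // [M /id_component_sub/HU //|M M' HoM HoM'].
by rewrite -[M]invmxK; apply: divH => //; apply: VH.
Qed.

(** Closedness relative to GL_n, since an algebraic subgroup need not be closed among all
    matrices. *)
Definition rel_closed S := forall M, M \in unitmx ->
  (forall p, vanish S p -> mxeval p M = 0) -> S M.

Lemma zeroGL_rel_closed ps : rel_closed (zeroGL ps).
Proof.
move=> M M_unit SM; split=> // p ps_p; apply: SM => g [_].
exact.
Qed.

(** The closure of the component in GL_n is still connected: if one closed set of a cover misses the
    component, the other contains it and hence its closure. As this closure stays in [H], it is part
    of the component. *)
Lemma id_component_rel_closed H : is_subgroup H -> rel_closed H ->
  rel_closed (id_component H).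
Proof.
move=> sH H_closed M M_unit HM.
have [HoU Ho1 _ _] := id_component_subgroup sH.
pose A x := x \in unitmx /\ forall p, vanish (id_component H) p -> mxeval p x = 0.
have HoA x : id_component H x -> A x by move=> Hx; split=> [|p]; [apply: HoU|apply].
exists A; split=> //; last exact: HoA.
- move=> C1 C2 C1_closed C2_closed cover [x1 Ax1 C1x1] [x2 Ax2 C2x2].
  have absent C C' x : zariski_closed C' -> (forall y, A y -> C y \/ C' y) -> A x -> C x ->
      ~ (exists2 y, id_component H y & C y) -> C' x.
    case=> P C'P cov [_ Ax] Cx no_y; apply/C'P => p Pp; apply: Ax => y Hy.
    by have [Cy|/C'P] := cov y (HoA y Hy); [case: no_y; exists y|apply].
  have [y1|no_y1] := classic (exists2 y, id_component H y & C1 y); last first.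
    by exists x1 => //; split=> //; apply: absent no_y1.
  have [y2|no_y2] := classic (exists2 y, id_component H y & C2 y); last first.
    exists x2 => //; split=> //; apply: (absent C2 C1) => // y /cover[]; [right|left] => //.
  have [|y Hy Cy] := id_component_connected C1_closed C2_closed _ y1 y2.
    by move=> y /HoA/cover.
  by exists y => //; apply: HoA.
- move=> x [x_unit Ax]; apply: H_closed => // p Hp; apply: Ax => y /id_component_sub.
  exact: Hp.
Qed.

End IdentityComponent.

(** * The closed subgroup generated by exponentials *)

Section CharKernel.
Variables (k : closedFieldType) (n : nat).
Hypothesis k_char0 : [pchar k] =i pred0.
Variables G K : 'M[k]_n -> Prop.
Hypotheses (sG : is_subgroup G) (G_connected : zariski_connected G).
Implicit Types (p q f : {mpoly k[n * n]}) (X g u M : 'M[k]_n) (S : 'M[k]_n -> Prop).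

Let G1 : G 1%:M. Proof. by case: sG. Qed.
Let GM a b : G a -> G b -> G (a *m b). Proof. by case: sG => _ _ H _; apply: H. Qed.
Let GV a : G a -> G (invmx a). Proof. by case: sG => _ _ _; apply. Qed.
Let GU a : G a -> a \in unitmx. Proof. by case: sG => H _ _ _; apply: H. Qed.

Lemma expr_conj g X i : g \in unitmx ->
  (g *m X *m invmx g) ^+ i = g *m X ^+ i *m invmx g.
Proof.
move=> g_unit; elim: i => [|i IHi]; first by rewrite mulmx1 mulmxV.
rewrite !exprS IHi -[_ * (g *m _ *m _)]/(_ *m (g *m _ *m _)) -[X * _]/(X *m _).
by rewrite !mulmxA mulmxKV.
Qed.

Lemma expmx_conj g X e t : g \in unitmx ->
  expmx (g *m X *m invmx g) e t = g *m expmx X e t *m invmx g.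
Proof.
move=> g_unit; rewrite /expmx mulmx_sumr mulmx_suml; apply: eq_bigr => i _.
by rewrite expr_conj // -scalemxAr -scalemxAl.
Qed.

Definition lie_unipotent u :=
  exists X e t, [/\ lie G X, X ^+ e = 0 & u = expmx X e.+1 t].

(** Only containment of the exponentials is required; the closed subgroup they generate is the
    intersection [N] of all such [S]. *)
Definition unipotently_generated S :=
  [/\ is_subgroup S, rel_closed S & forall u, lie_unipotent u -> S u].

Hypothesis K_gen : unipotently_generated K.

Let N M := forall S, unipotently_generated S -> S M.

Let N_sub : subset_of N K. Proof. by move=> M; apply. Qed.

Let sN : is_subgroup N.
Proof.
split=> [M NM'|S [[_ S1 _ _] _ _]|a b Na Nb S genS|a Na S genS] //.
- by have [[KU _ _ _] _ _] := K_gen; apply/KU/N_sub.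
- by have [[_ _ SM _] _ _] := genS; apply: SM; [exact: Na|exact: Nb].
- by have [[_ _ _ SV] _ _] := genS; apply: SV; apply: Na.
Qed.

Let N_closed : rel_closed N.
Proof.
move=> M M_unit NM' S genS; have [_ S_closed _] := genS.
by apply: S_closed => // p Sp; apply: NM' => x Nx; apply: Sp; apply: Nx.
Qed.

(** Conjugation by [g] permutes the exponentials, so the preimage of any admissible [S] under it is
    again admissible and contains [N]. *)
Let N_conj g u : G g -> N u -> N (g *m u *m invmx g).
Proof.
move=> Gg Nu S [sS S_closed S_unip]; have g_unit := GU Gg.
have [SU S1 SM SV] := sS.
have [] // : u \in unitmx /\ S (g *m u *m invmx g).
apply: (Nu (fun M => M \in unitmx /\ S (g *m M *m invmx g))); split.
- split=> [M []//||a b [a_unit Sa] [b_unit Sb]|a [a_unit Sa]].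
  + by rewrite unitmx1 mulmx1 mulmxV.
  + rewrite unitmx_mul a_unit b_unit; split=> //.
    have -> : g *m (a *m b) *m invmx g = (g *m a *m invmx g) *m (g *m b *m invmx g).
      by rewrite !mulmxA mulmxKV.
    exact: SM.
  + rewrite unitmx_inv; split=> //.
    have -> : g *m invmx a *m invmx g = invmx (g *m a *m invmx g).
      rewrite -[LHS]mul1mx -(@mulVmx _ _ (g *m a *m invmx g)) ?SU // -!mulmxA.
      by rewrite mulKmx // mulKVmx // mulmxV // mulmx1.
    exact: SV.
- move=> M M_unit SM'; split=> //; apply: S_closed => [|p Sp].
    by rewrite !unitmx_mul g_unit M_unit unitmx_inv.
  rewrite -mxeval_translate; apply: SM' => x [_ Sx].
  by rewrite mxeval_translate Sp.
- move=> _ [X [e [t [gX Xe ->]]]]; split.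
    by apply: unipotent_unitmx; apply: expmx_unipotent.
  rewrite -expmx_conj //; apply: S_unip; exists (g *m X *m invmx g), e, t; split=> //.
    exact: lie_conj.
  by rewrite expr_conj // Xe mulmx0 mul0mx.
Qed.

(** On [N], [c] is multiplicative and equals f (u) / f (1). Along s -> exp (s X) it is a polynomial
    without zeros, hence constant over an algebraically closed field. So {c = 1} is a closed
    subgroup containing the exponentials, and minimality of [N] concludes. *)
Let N_char_trivial c f : (forall x u, N u -> mxeval f (x *m u) = c u * mxeval f x) ->
  mxeval f 1%:M != 0 -> forall u, N u -> c u = 1.
Proof.
move=> cP f1; have [NU N1 NM NV] := sN.
have cE u : N u -> c u = mxeval f u / mxeval f 1%:M.
  by move=> Nu; rewrite -[u in mxeval f u]mul1mx cP // mulfK.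
have cM a b : N a -> N b -> c (a *m b) = c a * c b.
  move=> Na Nb; apply: (mulIf f1); rewrite -cP; last exact: NM.
  by rewrite mulmxA cP // cP // mulrA [c b * _]mulrC.
have c1 : c 1%:M = 1 by rewrite cE // divff.
have c_neq0 u : N u -> c u != 0.
  move=> Nu; apply/eqP => cu0; have := cM _ _ Nu (NV _ Nu).
  by rewrite mulmxV ?NU // c1 cu0 mul0r => /eqP; rewrite oner_eq0.
suff gen : unipotently_generated (fun u => N u /\ c u = 1).
  by move=> u Nu; have [] := Nu _ gen.
split.
- split=> [u [/NU]//||a b [Na ca] [Nb cb]|a [Na ca]]; first by split.
    by split; [apply: NM|rewrite cM // ca cb mulr1].
  split; first exact: NV.
  by have := cM _ _ Na (NV _ Na); rewrite mulmxV ?NU // c1 ca mul1r.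
- move=> M M_unit SM; have NM' : N M.
    by apply: N_closed => // p Np; apply: SM => x [Nx _]; apply: Np.
  split=> //; rewrite cE //.
  have : mxeval (f - (mxeval f 1%:M)%:MP) M = 0.
    apply: SM => x [Nx cx]; rewrite mxevalB mxevalC -[x]mul1mx cP // cx mul1r subrr //.
  by rewrite mxevalB mxevalC => /eqP; rewrite subr_eq0 => /eqP->; rewrite divff.
move=> _ [X [e [t [gX Xe ->]]]].
have Nexp s : N (expmx X e.+1 s).
  by move=> S [_ _]; apply; exists X, e, s.
split=> //; rewrite cE //.
pose F := mxev polyC (exp_curve X e.+1) f.
have FE s : F.[s] = mxeval f (expmx X e.+1 s) by rewrite horner_mxev horner_exp_curve.
have /eqP/size_poly1P[a nz_a F_const] : size F = 1%N.
  apply/eqP/negPn/negP => /closed_rootP[s]; rewrite rootE FE.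
  have := c_neq0 _ (Nexp s); rewrite cE // => /negPf nz.
  by move/eqP => f0; rewrite f0 mul0r eqxx in nz.
have /eqP := FE t; have := FE 0; rewrite expmx0 F_const !hornerC => <- /eqP <-.
by rewrite divff.
Qed.

Let invariant p := forall g u, G g -> N u -> mxeval p (g *m u) = mxeval p g.

(** Stability under the Lie algebra uses that [G] normalizes [N]: a u s = a s (s^-1 u s). For
    nilpotent Z, p (g exp (t Z)) is constant in t, and its derivative at 0 is [invder Z p] at g. *)
Let invariant_unipotent : unipotent_invariants G invariant.
Proof.
split.
- split=> [g u _ _|a p q Wp Wq g u Gg Nu]; first by rewrite !mxeval0.
  by rewrite !mxevalD !mxevalZ Wp // Wq.
- move=> X p gX Wp a u Ga Nu; rewrite !(mxeval_invder_translate X p).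
  have vanish_q : vanish G (translate (a *m u) 1%:M p - translate a 1%:M p).
    move=> s Gs; rewrite mxevalB; apply/eqP; rewrite subr_eq0; apply/eqP.
    transitivity (mxeval p (a *m u *m s)); first by rewrite mxeval_translate mulmx1.
    transitivity (mxeval p (a *m s)); last by rewrite mxeval_translate mulmx1.
    have -> : a *m u *m s = (a *m s) *m (invmx s *m u *m invmx (invmx s)).
      by rewrite invmxK !mulmxA mulmxK // GU.
    by apply: Wp; [apply: GM|apply: N_conj => //; apply: GV].
  have := gX _ vanish_q; rewrite linearB mxevalB /= => /eqP.
  by rewrite subr_eq0 => /eqP.
- move=> Z e p gZ Ze Wp g Gg.
  pose A := map_mx polyC g *m exp_curve Z e.+1.
  have evA t : map_mx (horner_eval t) A = g *m expmx Z e.+1 t.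
    rewrite map_mxM horner_exp_curve; congr (_ *m _).
    by apply/matrixP => i j; rewrite !mxE; apply: hornerC.
  have dA : map_mx deriv A = A *m map_mx polyC Z.
    rewrite /A -mulmxA -deriv_exp_curve ?exprS ?Ze ?mulr0 //.
    apply/matrixP => i j; rewrite !mxE raddf_sum; apply: eq_bigr => r _ /=.
    by rewrite !mxE derivM derivC mul0r add0r.
  have const : mxev polyC A p = (mxeval p g)%:P.
    apply/eqP; rewrite -subr_eq0; apply/eqP/closed_poly_eq0 => t.
    rewrite hornerD hornerN hornerC horner_mxev evA Wp ?subrr //.
    by move=> S [_ _]; apply; exists Z, e, t.
  have := congr1 (fun h : {poly k} => h^`().[0]) const.
  by rewrite /= (deriv_mxev _ dA) derivC horner0 horner_mxev evA expmx0 mulmx1.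
Qed.

Lemma char_kernel_sub : subset_of (char_kernel G) K.
Proof.
move=> g kg; apply: N_sub; apply: N_closed => [|p Np]; first by apply: GU; case: kg.
have [F [c [Fc [f Ff f1] sep]]] := chevalley sN Np.
apply: sep => q Fq.
apply: (unipotent_invariants_char_kernel k_char0 sG G_connected invariant_unipotent _ kg).
move=> x u _ Nu; rewrite Fc // (N_char_trivial _ f1) ?mul1r // => y v.
exact: Fc.
Qed.

End CharKernel.

(** Characters take values in a commutative group, so they are constant on conjugacy classes of
    [G]. *)
Lemma normal_char_kernel (k : closedFieldType) n (G K : 'M[k]_n -> Prop) :
  is_subgroup G -> is_subgroup K -> subset_of K G ->
  subset_of (char_kernel G) K -> normal_subgroup (char_kernel G) K.
Proof.
move=> [GU G1 GM GV] sK KG ckK.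
have chi1 chi : is_character G chi -> chi 1%:M = 1.
  move=> [_ chi_neq0 chiM]; apply: (mulfI (chi_neq0 _ G1)).
  by rewrite -chiM // mulmx1 mulr1.
split=> //.
- split=> [M [/GU]//||M M' [HM' chM] [HM'' chM']|M [HM' chM]].
  + by split=> // chi; apply: chi1.
  + split=> [|chi chi_char]; first exact: GM.
    by have [_ _ ->] := chi_char; rewrite ?chM ?chM' ?mulr1.
  + split=> [|chi chi_char]; first exact: GV.
    have [_ _ chiM] := chi_char.
    have := chiM _ _ HM' (GV _ HM').
    by rewrite mulmxV ?GU // chi1 // chM // mul1r.
- move=> g h Kg [Gh ch_h]; have Gg := KG _ Kg.
  split=> [|chi chi_char]; first by apply: (GM _ _ (GM _ _ Gg Gh)); apply: GV.
  have [_ _ chiM] := chi_char.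
  have GVg := GV _ Gg.
  rewrite (chiM _ _ (GM _ _ Gg Gh) GVg) (chiM _ _ Gg Gh) ch_h // mulr1 -chiM //.
  by rewrite mulmxV ?GU // chi1.
Qed.

Lemma unipotent_normality (k : closedFieldType) n (H' Hbar : alg_subgroup k n) :
  [pchar k] =i pred0 -> subset_of (points H') (points Hbar) ->
  (forall u, points Hbar u -> unipotent u -> id_component (points H') u) ->
  normal_subgroup (char_kernel (id_component (points Hbar))) (id_component (points H')).
Proof.
move=> k0 H'Hbar unipH'.
have sG := id_component_subgroup (pointsP Hbar).
have sK := id_component_subgroup (pointsP H').
apply: normal_char_kernel => //.
  by move=> M [A [A_conn AH' A1 AM]]; exists A; split=> // x /AH'/H'Hbar.
apply: char_kernel_sub => //; first exact: id_component_connected.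
split=> //.
  by apply: id_component_rel_closed; [apply: pointsP|apply: zeroGL_rel_closed].
move=> _ [X [e [t [gX Xe ->]]]]; have unip := expmx_unipotent t Xe.
apply: unipH' => //; split; first exact: unipotent_unitmx.
move=> p Hbar_p; apply: (lie_expmx k0 sG t gX Xe) => x /id_component_sub[_].
exact.
Qed.

Theorem corollary3p2 (k : closedFieldType) (k_computable : computable_field k)
    (k_char0 : [pchar k] =i pred0) (n : nat) (n_gt1 : (1 < n)%N)
    (s : 'S_(n * n)) :
  d3 n <= d3_bound n /\
  forall F : alg_subgroup k n -> Prop,
    (forall H, F H ->
      triangular_rep_bounded s (d3 n) (ideal_gen (equations H))) ->
    (forall H' : alg_subgroup k n, exists2 Hbar, F Hbar &
      subset_of (points H') (points Hbar) /\
      forall u, points Hbar u -> unipotent u ->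
        id_component (points H') u) ->
    forall H' : alg_subgroup k n, exists2 Hbar, F Hbar &
      [/\ normal_subgroup (char_kernel (id_component (points Hbar)))
                          (id_component (points H')),
          subset_of (id_component (points H')) (points H') &
          subset_of (points H') (points Hbar)].
Proof.
split=> [|F _ F_ex H']; first exact: d3_le_d3_bound.
have [Hbar FHbar [H'_Hbar unip_H']] := F_ex H'; exists Hbar => //.
split=> //; first exact: unipotent_normality.
exact: id_component_sub.
Qed.
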